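(* For $\nu>0$ define $f_\nu(x)=(1-x^2)^\nu$ for $|x|<1$ and $f_\nu(x)=0$ otherwise; for $X>0$ define $$g_{\nu,X}(x)=\frac{\Gamma(\frac32+2\nu)}{\sqrt\pi\,\Gamma(1+2\nu)}\int_{\mathbb{R}}f_\nu(y)f_\nu\!\left(\frac{2x}{X}-y\right)dy\quad(x\ge0),$$ and $h_{\nu,X}(t)=2\int_0^\infty g_{\nu,X}(x)\cos(tx)\,dx$. Then $g_{\nu,X}(0)=1$, $g_{\nu,X}$ is supported on $[0,X]$, $h_{\nu,X}$ is non-negative, and for any fixed $\varepsilon>0$, $$h_{\nu,X}(t)\ll_\varepsilon\nu^{-1/2}e^{-2\nu}X\left|\frac{4\nu}{Xt}\right|^{2\nu+2}$$ uniformly for $\left|\frac{Xt}{4}\right|\ge\nu\ge\varepsilon$. *)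

(* Defs.v *)
From HB Require Import structures.
From mathcomp Require Import all_boot all_order all_algebra.
From mathcomp Require Import all_classical all_reals all_analysis.
Set Implicit Arguments. Unset Strict Implicit. Unset Printing Implicit Defensive.
Import Order.TTheory GRing.Theory Num.Theory.
Import numFieldNormedType.Exports.
Local Open Scope classical_set_scope.
Local Open Scope ring_scope.

Section Defs.
Variable R : realType.

Definition Gamma (s : R) : R :=
  Rintegral lebesgue_measure `]0, +oo[ (fun t : R => t `^ (s - 1) * expR (- t)).

Definition f_nu (nu x : R) : R :=
  if `|x| < 1 then (1 - x ^+ 2) `^ nu else 0.

Definition g_nuX (nu X x : R) : R :=
  Gamma (3 / 2 + 2 * nu) / (Num.sqrt pi * Gamma (1 + 2 * nu)) *
  Rintegral lebesgue_measure setT (fun y : R => f_nu nu y * f_nu nu (2 * x / X - y)).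

Definition h_nuX (nu X t : R) : R :=
  2 * Rintegral lebesgue_measure `[0, +oo[ (fun x : R => g_nuX nu X x * cos (t * x)).

End Defs.

(* Main.v *)
Require Import Defs.
From HB Require Import structures.
From mathcomp Require Import all_boot all_order all_algebra.
From mathcomp Require Import all_classical all_reals all_analysis.
From mathcomp Require Import measurable_realfun ring lra.
Set Implicit Arguments. Unset Strict Implicit. Unset Printing Implicit Defensive.
Import Order.TTheory GRing.Theory Num.Theory.
Import numFieldNormedType.Exports.
Local Open Scope classical_set_scope.
Local Open Scope ring_scope.

(** Write [F nu s] for the integral of [(1 - y^2)^nu cos (s y)] over [[-1, 1]].
    Fubini gives [h nu X t = c (X / 2) (F nu (t X / 2))^2], whence positivity; the
    constant [c] is the inverse of the integral of [(1 - y^2)^(2 nu)] by the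
    Beta-Gamma identity, whence [g nu X 0 = 1] and [c = O (sqrt nu)].

    For the decay, put [W nu s = s^(nu+1) F nu s], essentially
    [2^nu Gamma (nu+1) sqrt s J_(nu+1/2) (s)].  For [nu >= 1] the pair
    [a = 2 nu W (nu-1), b = W nu] solves [a' = (nu/s) a - b], [b' = a - (nu/s) b], so
    [(1 - nu/s) (a^2 + b^2 - 2 (nu/s) a b)] is nondecreasing on [s >= nu].  Hence
    [W nu s] is bounded, for [s >= 2 nu], by the values of [a] and [b] at infinity.
    These are transported by the three-term recurrence in [nu], whose middle term
    vanishes at infinity, from the range [0 <= nu <= 2], where two integrations by
    parts away from the endpoint suffice. *)

(** * Calculus and the power of [1 - y^2] *)

Section Calculus.
Variable R : realType.
Notation mu := (@lebesgue_measure R).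
Implicit Types (f F : R -> R) (a b nu s x y : R).

(** Fixed-order asymptotics are not enough, because the constant must be uniform in [nu]. The way
    out is that the point beyond which a bound holds may depend on [nu] arbitrarily: monotonicity of
    the energy carries the bound from a very distant point back to every [s >= 2 nu] at the cost of
    an absolute factor. The energy has a Hamiltonian origin: the system for [a, b] consists of
    Hamilton's equations for half of [a^2 + b^2 - 2 (nu/s) a b], whose explicit [s]-derivative has
    the indefinite sign of [a b]; the weight [1 - nu/s] completes it to a nonnegative form. The
    condition [|X t / 4| >= nu] is [s >= 2 nu] at [s = |t X / 2|], so [1 - nu/s >= 1/2] and the
    energy controls both squares. The recurrence multiplies by [4 nu (nu - 1)] every two orders; an
    explicit majorant [M] with [M (nu + 1) >= 2 (nu + 1) M nu] absorbs this. Up to constants its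
    square is [e^(-2 nu) (2 nu)^(2 nu + 2) / nu], and the [sqrt nu] from [c] leaves [nu^(-1/2)]. *)

Lemma continuous_itv_integrable a b f : continuous f ->
  mu.-integrable `[a, b] (EFin \o f).
Proof.
move=> cf; apply: continuous_compact_integrable; first exact: segment_compact.
exact: continuous_subspaceT.
Qed.

(** The derivative is asked for in the open interval only, since the formula for the derivative of
    [bump] is available for [|y| < 1] while the integrals run up to 1. *)
Lemma Rintegral_FTC2 a b f F : a <= b -> continuous f -> continuous F ->
  (forall x, a < x < b -> is_derive x 1 F (f x)) ->
  \int[mu]_(x in `[a, b]) f x = F b - F a.
Proof.
rewrite le_eqVlt => /predU1P[->|ab] cf cF dF.
  by rewrite set_itv1 Rintegral_set1 subrr.
rewrite /Rintegral (@continuous_FTC2 _ f F)//.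
- exact: continuous_subspaceT.
- split.
  + by move=> x; rewrite in_itv/= => /dF h; exact: ex_derive.
  + exact/cvg_at_right_filter/cF.
  + exact/cvg_at_left_filter/cF.
- by move=> x; rewrite in_itv/= => /dF h; rewrite derive1E derive_val.
Qed.

Lemma continuous_max0_powR nu : 0 <= nu ->
  continuous (fun x : R => (Num.max x 0) `^ nu).
Proof.
rewrite le_eqVlt => /predU1P[<-|nu0].
  by move=> x; under eq_fun do rewrite powRr0; exact: cvg_cst.
move=> x; have [x0|x0|->] := ltgtP x (0 : R).
- rewrite /continuous_at max_r ?ltW// powR0 ?gt_eqF//.
  apply: cvg_near_cst; near=> y.
  have y0 : y < 0 by near: y; exact: lt_nbhsl.
  by rewrite /= max_r ?ltW// powR0 ?gt_eqF.
- apply: (@cvg_trans _ (y `^ nu @[y --> x])); last first.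
    rewrite max_l ?ltW//.
    have : derivable (fun y : R => y `^ nu) x 1.
      by apply: derivable_powR; rewrite in_itv/= x0.
    by move/derivable1_diffP/differentiable_continuous.
  apply: near_eq_cvg; near=> y.
  have y0 : 0 < y by near: y; exact: lt_nbhsr.
  by rewrite max_l ?ltW.
- rewrite /continuous_at maxxx powR0 ?gt_eqF//; apply/cvgrPdist_le => e e0.
  near=> y; rewrite sub0r normrN ger0_norm ?powR_ge0//.
  (* The radius of the neighbourhood of 0 is [e^(1/nu)]. *)
  have -> : e = (e `^ nu^-1) `^ nu.
    by rewrite -powRrM mulVf ?gt_eqF// powRr1// ltW.
  apply: ge0_ler_powR; rewrite ?nnegrE ?powR_ge0 ?le_max ?lexx ?orbT ?ltW//.
  rewrite gt_max powR_gt0// andbT.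
  by near: y; apply: lt_nbhsl; rewrite powR_gt0.
Unshelve. all: by end_near. Qed.

(** Clipping at 0 encodes the extension by zero as one continuous function of [y], because [powR]
    takes the value 1 at a negative base. It agrees with [f_nu] for [nu > 0]; at [nu = 0] it is
    constantly 1, so order 0 enters only through integrals over [[0, 1]]. Negative exponents arise
    from differentiation and are evaluated at interior points. *)
Definition bump nu y : R := (Num.max (1 - y ^+ 2) 0) `^ nu.

Lemma bump_ge0 nu y : 0 <= bump nu y. Proof. exact: powR_ge0. Qed.

Lemma bump_le1 nu y : 0 <= nu -> bump nu y <= 1.
Proof.
move=> nu0; rewrite -[leRHS](congr1 (@^~ nu) (powR1 R)); apply: ge0_ler_powR => //.
- by rewrite nnegrE le_max lexx orbT.
- by rewrite nnegrE.
- by rewrite ge_max ler01 andbT gerBl sqr_ge0.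
Qed.

Lemma bumpN nu y : bump nu (- y) = bump nu y.
Proof. by rewrite /bump sqrrN. Qed.

Lemma onem_sqr_gt0 y : -1 < y < 1 -> 0 < 1 - y ^+ 2 :> R.
Proof. by move=> /andP[? ?]; nra. Qed.

Lemma bumpE nu y : -1 < y < 1 -> bump nu y = (1 - y ^+ 2) `^ nu.
Proof. by move=> y1; rewrite /bump max_l// ltW// onem_sqr_gt0. Qed.

Lemma bump_out nu y : nu != 0 -> 1 <= `|y| -> bump nu y = 0.
Proof.
move=> nu0 y1; rewrite /bump max_r ?powR0// subr_le0 -real_normK ?num_real//.
by rewrite expr_ge1.
Qed.

Lemma bumpS nu y : nu != -1 -> -1 < y < 1 -> bump (nu + 1) y = (1 - y ^+ 2) * bump nu y.
Proof.
move=> nu1 y1; have y0 := onem_sqr_gt0 y1.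
rewrite !bumpE// powRD ?powRr1 1?mulrC ?ltW//.
by apply/implyP => _; rewrite gt_eqF.
Qed.

Lemma continuous_bump nu : 0 <= nu -> continuous (bump nu).
Proof.
move=> nu0 y; apply: (@continuous_comp _ _ _ (fun y : R => 1 - y ^+ 2)
  (fun x : R => (Num.max x 0) `^ nu)); last exact: continuous_max0_powR.
by apply: cvgB; [exact: cvg_cst|exact: exprn_continuous].
Qed.

Lemma is_derive_bump nu y : -1 < y < 1 ->
  is_derive y 1 (bump nu) (- (2 * nu) * y * bump (nu - 1) y).
Proof.
move=> y1; have y0 := onem_sqr_gt0 y1.
have h1 : is_derive y 1 (fun y : R => 1 - y ^+ 2) (- (2 * y)).
  by apply: is_derive_eq; rewrite /GRing.scale/=; ring.
have h2 := is_derive1_powR nu y0.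
have h3 := @is_derive1_comp _ (fun x : R => x `^ nu) (fun y : R => 1 - y ^+ 2) y _ _ h2 h1.
apply: (@near_eq_is_derive _ _ _ ((fun x : R => x `^ nu) \o (fun y : R => 1 - y ^+ 2))).
- have /andP[y1' y2'] := y1.
  near=> z; rewrite /= bumpE//.
  by apply/andP; split; near: z; [exact: lt_nbhsr|exact: lt_nbhsl].
- by apply: is_derive_eq; rewrite bumpE//; ring.
Unshelve. all: by end_near. Qed.

Lemma continuous_cosM s : continuous (fun y : R => cos (s * y)).
Proof.
move=> y; apply: (@continuous_comp _ _ _ (fun y : R => s * y) (@cos R)).
  by apply: cvgM; [exact: cvg_cst|exact: cvg_id].
exact: continuous_cos.
Qed.

Lemma continuous_sinM s : continuous (fun y : R => sin (s * y)).
Proof.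
move=> y; apply: (@continuous_comp _ _ _ (fun y : R => s * y) (@sin R)).
  by apply: cvgM; [exact: cvg_cst|exact: cvg_id].
exact: continuous_sin.
Qed.

Global Instance is_derive_cosM s y :
  is_derive y 1 (fun y : R => cos (s * y)) (- (s * sin (s * y))).
Proof.
have h := @is_derive1_comp _ (@cos R) (fun y : R => s * y) y _ _
  (is_derive_cos _) (is_deriveM _ _).
by apply: is_derive_eq; rewrite /GRing.scale/=; ring.
Qed.

Global Instance is_derive_sinM s y :
  is_derive y 1 (fun y : R => sin (s * y)) (s * cos (s * y)).
Proof.
have h := @is_derive1_comp _ (@sin R) (fun y : R => s * y) y _ _
  (is_derive_sin _) (is_deriveM _ _).
by apply: is_derive_eq; rewrite /GRing.scale/=; ring.
Qed.

End Calculus.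

(** * The cosine transform and its recurrences *)

Section ContinuousCombinators.
Variable R : realType.
Implicit Types f g : R -> R.

Lemma continuous_cst_fun (c : R) : continuous (fun _ : R => c).
Proof. by move=> x; exact: cvg_cst. Qed.

Lemma continuous_id_fun : continuous (fun x : R => x).
Proof. by move=> x; exact: cvg_id. Qed.

Lemma continuousD_fun f g : continuous f -> continuous g ->
  continuous (fun x => f x + g x).
Proof. by move=> cf cg x; apply: cvgD; [exact: cf|exact: cg]. Qed.

Lemma continuousM_fun f g : continuous f -> continuous g ->
  continuous (fun x => f x * g x).
Proof. by move=> cf cg x; apply: cvgM; [exact: cf|exact: cg]. Qed.

Lemma continuousN_fun f : continuous f -> continuous (fun x => - f x).
Proof. by move=> cf x; apply: cvgN; exact: cf. Qed.

End ContinuousCombinators.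

Ltac continuity_tac := lazymatch goal with
  | |- continuous (fun _ => ?c) => exact: continuous_cst_fun
  | |- continuous (fun x => x) => exact: continuous_id_fun
  | |- continuous (fun x => cos (?s * x)) => exact: continuous_cosM
  | |- continuous (fun x => sin (?s * x)) => exact: continuous_sinM
  | |- continuous (fun x => bump ?nu x) => by apply: continuous_bump
  | |- continuous (fun x => @?f x + @?g x) =>
      apply: (@continuousD_fun _ f g); continuity_tac
  | |- continuous (fun x => @?f x * @?g x) =>
      apply: (@continuousM_fun _ f g); continuity_tac
  | |- continuous (fun x => - @?f x) =>
      apply: (@continuousN_fun _ f); continuity_tac
  end.

Section Bessel.
Variable R : realType.
Notation mu := (@lebesgue_measure R).
Implicit Types (nu s y : R).

(* Half of the transform, the integrand being even. *)
Definition cosT nu s := \int[mu]_(y in `[0, 1]) (bump nu y * cos (s * y)).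
Definition sin_moment nu s := \int[mu]_(y in `[0, 1]) (y * bump nu y * sin (s * y)).

Lemma continuous_cosT_integrand nu s : 0 <= nu ->
  continuous (fun y => bump nu y * cos (s * y)).
Proof. by move=> nu0; continuity_tac. Qed.

Lemma continuous_sin_moment_integrand nu s : 0 <= nu ->
  continuous (fun y => y * bump nu y * sin (s * y)).
Proof. by move=> nu0; continuity_tac. Qed.

Lemma cosT_norm nu s : cosT nu `|s| = cosT nu s.
Proof.
apply: eq_Rintegral => y _; congr (_ * _).
by case: (ler0P s) => // _; rewrite mulNr cosN.
Qed.

Lemma cosT_le1 nu s : 0 <= nu -> `|cosT nu s| <= 1.
Proof.
move=> nu0.
have c := @continuous_cosT_integrand nu s nu0.
apply: le_trans (le_normr_Rintegral _ _) _ => //.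
  exact: continuous_itv_integrable.
apply: (@le_trans _ _ (\int[mu]_(y in `[0, 1]) (1 : R))).
  apply: le_Rintegral => //.
  - by apply: continuous_itv_integrable => y; apply: cvg_norm; exact: c.
  - by apply: continuous_itv_integrable => y; exact: cvg_cst.
  - move=> y _; rewrite normrM (ger0_norm (bump_ge0 _ _)).
    by rewrite mulr_ile1 ?bump_ge0 ?bump_le1 ?cos_max.
rewrite Rintegral_cst//= lebesgue_measure_itv/= lte_fin ifT//=; lra.
Qed.

(* Integrate the derivative of [(1 - y^2)^nu sin (s y)]. *)
Lemma sin_moment_pred nu s : 1 <= nu -> 2 * nu * sin_moment (nu - 1) s = s * cosT nu s.
Proof.
move=> nu1; have nu0 : 0 <= nu by lra. have nu10 : 0 <= nu - 1 by lra.
have nun : nu != 0 by rewrite gt_eqF//; lra.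
pose f y := s * (bump nu y * cos (s * y)) - 2 * nu * (y * bump (nu - 1) y * sin (s * y)).
have : \int[mu]_(y in `[0, 1]) f y = 0.
  apply: (etrans (@Rintegral_FTC2 _ _ _ _ (fun y => bump nu y * sin (s * y)) _ _ _ _)).
  - lra.
  - by rewrite /f; continuity_tac.
  - by continuity_tac.
  - move=> y /andP[? ?]; have y1 : -1 < y < 1 by apply/andP; lra.
    have h := is_derive_bump nu y1.
    by apply: is_derive_eq; rewrite /f /GRing.scale/=; ring.
  - by rewrite bump_out ?normr1// mulr0 sin0 mulr0 mul0r subrr.
rewrite RintegralB// ?RintegralZl//; first last.
- by apply: continuous_itv_integrable; continuity_tac.
- by apply: continuous_itv_integrable; continuity_tac.
- by apply: continuous_itv_integrable; continuity_tac.
- by apply: continuous_itv_integrable; continuity_tac.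
by move/eqP; rewrite subr_eq0 => /eqP.
Qed.

(* Integrate the derivative of [y (1 - y^2)^nu cos (s y)]. *)
Lemma sin_moment_rec nu s : 1 <= nu ->
  s * sin_moment nu s = (2 * nu + 1) * cosT nu s - 2 * nu * cosT (nu - 1) s.
Proof.
move=> nu1; have nu0 : 0 <= nu by lra. have nu10 : 0 <= nu - 1 by lra.
have nun : nu != 0 by rewrite gt_eqF//; lra.
pose f y := (2 * nu + 1) * (bump nu y * cos (s * y))
  - 2 * nu * (bump (nu - 1) y * cos (s * y)) - s * (y * bump nu y * sin (s * y)).
have : \int[mu]_(y in `[0, 1]) f y = 0.
  apply: (etrans (@Rintegral_FTC2 _ _ _ _ (fun y => y * bump nu y * cos (s * y)) _ _ _ _)).
  - lra.
  - by rewrite /f; continuity_tac.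
  - by continuity_tac.
  - move=> y /andP[? ?]; have y1 : -1 < y < 1 by apply/andP; lra.
    have h := is_derive_bump nu y1.
    apply: is_derive_eq; rewrite /f /GRing.scale/=.
    have -> : bump nu y = (1 - y ^+ 2) * bump (nu - 1) y.
      by rewrite -bumpS ?subrK// gt_eqF//; lra.
    by ring.
  - by rewrite bump_out ?normr1 ?mulr0 ?mul0r ?subrr.
rewrite !RintegralB// ?RintegralZl//; try by
  apply: continuous_itv_integrable; continuity_tac.
by move=> /eqP; rewrite subr_eq0 => /eqP.
Qed.

(** Eliminates [sin_moment nu] between the two identities above, the first taken at order [nu + 1].
    In Bessel terms this is [J_(m+1) + J_(m-1) = (2 m / s) J_m] at [m = nu + 1/2]. *)
Lemma cosT_rec nu s : 1 <= nu -> s ^+ 2 * cosT (nu + 1) s =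
  2 * (nu + 1) * ((2 * nu + 1) * cosT nu s - 2 * nu * cosT (nu - 1) s).
Proof.
move=> nu1; rewrite -sin_moment_rec// expr2 -mulrA -sin_moment_pred; last by lra.
by rewrite addrK; ring.
Qed.

Lemma is_derive_cosT nu s : 0 <= nu -> is_derive s 1 (cosT nu) (- sin_moment nu s).
Proof.
move=> nu0.
pose f s y := bump nu y * cos (s * y).
have df (x y : R) : is_derive x 1 (f ^~ y) (- (y * bump nu y * sin (x * y))).
  have h : is_derive x 1 (fun x => cos (x * y)) (- (y * sin (x * y))).
    under eq_fun do rewrite mulrC.
    by rewrite (mulrC x); exact: is_derive_cosM.
  by apply: is_derive_eq; rewrite /GRing.scale/=; ring.
have f1 (x y : R) : partial1of2 f x y = - (y * bump nu y * sin (x * y)).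
  by rewrite partial1of2E; have h := df x y; rewrite derive_val.
have mI : measurable (`[0, 1]%classic : set R) by [].
have Is : `](s - 1), (s + 1)[%classic s.
  by rewrite /= in_itv/= ltrBlDr ltrDl ltr01.
have intf (x : R) : `](s - 1), (s + 1)[%classic x -> mu.-integrable `[0, 1] (EFin \o f x).
  by move=> _; apply: continuous_itv_integrable; exact: continuous_cosT_integrand.
have df1 (x y : R) : `](s - 1), (s + 1)[%classic x -> `[0, 1]%classic y -> derivable (f ^~ y) x 1.
  by move=> _ _; exact: (@ex_derive _ _ _ _ _ _ _ (df x y)).
have G0 (y : R) : 0 <= (1 : R) by [].
have intG : mu.-integrable `[0, 1] (EFin \o (fun _ : R => 1 : R)).
  by apply: continuous_itv_integrable; exact: continuous_cst_fun.
have Gub (x y : R) : `](s - 1), (s + 1)[%classic x -> `[0, 1]%classic y ->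
    `|partial1of2 f x y| <= 1.
  move=> _; rewrite /= in_itv/= => /andP[y1 y2]; rewrite f1 normrN 2!normrM.
  rewrite (ger0_norm (bump_ge0 _ _)) mulr_ile1 ?mulr_ge0 ?bump_ge0 ?sin_max//.
  by rewrite mulr_ile1 ?bump_ge0 ?bump_le1// ger0_norm.
apply: DeriveDef.
  exact: (@derivable_under_integral R _ _ mu f _ mI s _ _ Is intf df1 (fun=> 1) G0 intG Gub).
rewrite -derive1E (@differentiation_under_integral R _ _ mu f _ mI s _ _ Is intf df1 (fun=> 1) G0 intG Gub).
under eq_Rintegral do rewrite f1 -mulN1r.
rewrite RintegralZl ?mulN1r//.
by apply: continuous_itv_integrable; exact: continuous_sin_moment_integrand.
Qed.

End Bessel.

(** * Concave amplitudes *)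

Section Oscillation.
Variable R : realType.
Notation mu := (@lebesgue_measure R).
Implicit Types (a b r s : R).

Lemma Rintegral_itv_split a b (c : R) (f : R -> R) : a <= b -> b <= c -> continuous f ->
  \int[mu]_(x in `[a, c]) f x =
  \int[mu]_(x in `[a, b]) f x + \int[mu]_(x in `[b, c]) f x.
Proof.
move=> ab bc cf; apply/eqP; rewrite addrC -subr_eq; apply/eqP.
rewrite Rintegral_itvB ?bnd_simp//; last exact: continuous_itv_integrable.
rewrite Rintegral_itv_obnd_cbnd//.
apply: (@integrableS _ _ _ mu `[b, c]) => //; last exact: continuous_itv_integrable.
by apply: subset_itvr; rewrite bnd_simp.
Qed.

(** The mean value theorem applied to [G] minus a primitive of [f] works with pointwise derivatives
    alone; in the application [dG] contains a second derivative that is known only pointwise. *)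
Lemma le_Rintegral_derive a b (f G dG : R -> R) : a <= b -> continuous f ->
  (forall x, a <= x <= b -> is_derive x 1 G (dG x)) ->
  (forall x, a < x < b -> f x <= dG x) ->
  \int[mu]_(x in `[a, b]) f x <= G b - G a.
Proof.
rewrite le_eqVlt => /predU1P[->|ab] cf dGP fG.
  by rewrite set_itv1 Rintegral_set1 subrr.
(* Starting the primitive at [a - 1] makes [a] an interior point, so that the derivative there is
   two-sided. *)
pose Phi x := \int[mu]_(t in `[a - 1, x]) f t.
have dPhi x : a <= x <= b -> is_derive x 1 Phi (f x).
  move=> /andP[ax xb].
  have [| | | |h1 h2] := @continuous_FTC1_closed R f (a - 1) x (b + 1).
  - by lra.
  - exact: continuous_itv_integrable.
  - by lra.
  - exact: cf.
  - by apply: DeriveDef; [exact: h1|rewrite -derive1E; exact: h2].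
have -> : \int[mu]_(x in `[a, b]) f x = Phi b - Phi a.
  by rewrite /Phi (@Rintegral_itv_split (a - 1) a b)//; lra.
have dH x : a <= x <= b -> is_derive x 1 (G \- Phi) (dG x - f x).
  by move=> xab; have h1 := dPhi _ xab; have h2 := dGP _ xab; exact: is_deriveB.
have [] := @MVT R (G \- Phi) (fun x => dG x - f x) a b ab.
- by move=> x; rewrite in_itv/= => /andP[? ?]; apply: dH; apply/andP; lra.
- apply: derivable_within_continuous => x; rewrite in_itv/= => /dH h.
  exact: ex_derive.
- move=> c; rewrite in_itv/= => cab /= e.
  have := fG _ cab; have : 0 < b - a by lra.
  by nra.
Qed.

(* [p v] differs from the derivative of [p u / s + p' v / s^2] by [p'' v / s^2],
   which concavity bounds by the derivative of [p' / s^2] up to sign. *)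
Lemma concave_oscillation (p p1 p2 u v : R -> R) r s : 0 <= r -> 0 < s ->
  continuous (fun x => p x * v x) ->
  (forall x : R, 0 <= x <= r -> is_derive x 1 p (p1 x)) ->
  (forall x : R, 0 <= x <= r -> is_derive x 1 p1 (p2 x)) ->
  (forall x : R, 0 < x < r -> p2 x <= 0) ->
  (forall x : R, is_derive x 1 u (s * v x)) ->
  (forall x : R, is_derive x 1 v (- (s * u x))) ->
  (forall x, `|u x| <= 1) -> (forall x, `|v x| <= 1) ->
  `|\int[mu]_(x in `[0, r]) (p x * v x)| <=
    (`|p r| + `|p 0 * u 0|) / s + 2 * (`|p1 r| + `|p1 0|) / s ^+ 2.
Proof.
move=> r0 s0 cpv dp dp1 p20 du dv u1 v1.
have s1 : 0 < s^-1 by rewrite invr_gt0.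
have sV : s * s^-1 = 1 by rewrite mulfV ?gt_eqF.
pose T := s^-1.
have key (e : R) : `|e| = 1 ->
    \int[mu]_(x in `[0, r]) (e * (p x * v x)) <=
    (`|p r| + `|p 0 * u 0|) / s + 2 * (`|p1 r| + `|p1 0|) / s ^+ 2.
  move=> e1.
  (* The terms in [p1 x * u x] cancel because [s * T = 1]. The last summand turns [p2 * e * v] into
     [p2 * (e * v - 1)], a product of two nonpositive factors; the choices [e = 1] and [e = -1] give
     the two sides of the absolute value. *)
  pose G (x : R) := e * (p x * u x * T + p1 x * v x * T ^+ 2) - p1 x * T ^+ 2.
  pose dG (x : R) := e * (p x * v x) + T ^+ 2 * (p2 x * (e * v x - 1)).
  have dGP (x : R) : 0 <= x <= r -> is_derive x 1 G (dG x).
    move=> xr; have h1 := dp _ xr; have h2 := dp1 _ xr.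
    have h3 := du x; have h4 := dv x.
    apply: is_derive_eq; rewrite /dG /GRing.scale/= /T.
    by field; rewrite gt_eqF.
  apply: le_trans (@le_Rintegral_derive 0 r _ G dG _ _ _ _) _ => //.
  - exact: continuousM_fun (@continuous_cst_fun _ e) cpv.
  - move=> x xr; rewrite /dG lerDl mulr_ge0 ?sqr_ge0//.
    rewrite mulr_le0// ?p20// subr_le0 (le_trans (ler_norm _))//.
    by rewrite normrM e1 mul1r.
  have Pu : e * (p r * u r) <= `|p r|.
    rewrite (le_trans (ler_norm _))// !normrM e1 mul1r.
    by rewrite ler_piMr ?u1.
  have Pu0 : - (e * (p 0 * u 0)) <= `|p 0 * u 0|.
    by rewrite (le_trans (ler_norm _))// normrN normrM e1 mul1r.
  have Qr : e * (p1 r * v r) - p1 r <= 2 * `|p1 r|.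
    rewrite (le_trans (ler_norm _))// (le_trans (ler_normB _ _))//.
    rewrite !normrM e1 mul1r mulr2n mulrDl mul1r lerD2r.
    by rewrite ler_piMr ?v1.
  have Q0 : - (e * (p1 0 * v 0) - p1 0) <= 2 * `|p1 0|.
    rewrite (le_trans (ler_norm _))// normrN (le_trans (ler_normB _ _))//.
    rewrite !normrM e1 mul1r mulr2n mulrDl mul1r lerD2r.
    by rewrite ler_piMr ?v1.
  have -> : G r - G 0 = (e * (p r * u r) - e * (p 0 * u 0)) * T
     + ((e * (p1 r * v r) - p1 r) - (e * (p1 0 * v 0) - p1 0)) * T ^+ 2.
    by rewrite /G; ring.
  rewrite -exprVn; apply: lerD.
    by apply: ler_wpM2r; [exact: ltW|exact: lerD].
  by apply: ler_wpM2r; [exact: sqr_ge0|rewrite mulrDr; exact: lerD].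
have int : mu.-integrable `[0, r] (EFin \o (fun x => p x * v x)).
  exact: continuous_itv_integrable.
rewrite ler_norml; apply/andP; split.
  rewrite lerNl; have := key (-1); rewrite normrN1 => /(_ erefl).
  by rewrite RintegralZl// mulN1r.
by have := key 1; rewrite normr1 => /(_ erefl); rewrite RintegralZl// mul1r.
Qed.

End Oscillation.

(** * Decay of the transform and of the sine moment for orders in [[0, 1]] *)

Section SmallOrder.
Variable R : realType.
Notation mu := (@lebesgue_measure R).
Implicit Types (nu s y : R).

Lemma powRVN s nu : 0 <= s -> s^-1 `^ nu = s `^ (- nu).
Proof. by move=> s0; rewrite -powR_inv1// -powRrM mulN1r. Qed.

(** Within [1/s] of the endpoint, [1 - y^2 = (1 - y) (1 + y) <= 2/s], and [2^nu <= 2] since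
    [nu <= 1]. *)
Lemma bump_le_cut nu s y : 0 <= nu <= 1 -> 1 <= s -> 1 - s^-1 <= y <= 1 ->
  bump nu y <= 2 * s `^ (- nu).
Proof.
move=> /andP[nu0 nu1] s1 /andP[y1 y2].
have s0 : 0 < s by lra.
have sV : 0 < s^-1 by rewrite invr_gt0.
have sV1 : s^-1 <= 1 by rewrite invf_le1.
rewrite -powRVN ?(ltW s0)//.
apply: (@le_trans _ _ ((2 * s^-1) `^ nu)).
  apply: ge0_ler_powR => //.
  - by rewrite nnegrE le_max lexx orbT.
  - by rewrite nnegrE; nra.
  - by rewrite ge_max; apply/andP; split; nra.
rewrite powRM ?(ltW sV)//; apply: ler_wpM2r; first exact: powR_ge0.
by rewrite ler1_powR// ler1n.
Qed.

(** At the cut [1 - y^2 >= 1 - y = 1/s], and the exponent [nu - 1 <= 0] reverses the inequality. *)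
Lemma bump_pred_le_cut nu s : nu <= 1 -> 1 <= s ->
  bump (nu - 1) (1 - s^-1) <= s * s `^ (- nu).
Proof.
move=> nu1 s1; have s0 : 0 < s by lra.
have sV : 0 < s^-1 by rewrite invr_gt0.
have sV1 : s^-1 <= 1 by rewrite invf_le1.
rewrite bumpE; last by apply/andP; lra.
have -> : s * s `^ (- nu) = (s^-1 `^ (1 - nu))^-1.
  rewrite powRVN ?(ltW s0)// -[X in X * _](@powRr1 _ s) ?(ltW s0)//.
  by rewrite -powRD ?(gt_eqF s0) ?implybT// -powRN opprK.
have B0 : 0 < 1 - (1 - s^-1) ^+ 2 by nra.
rewrite -(opprB 1 nu) powRN lef_pV2 ?posrE ?powR_gt0//.
by apply: ge0_ler_powR; rewrite ?nnegrE ?subr_ge0 ?(ltW sV) ?(ltW B0)//; nra.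
Qed.

(** The derivative of the amplitude may blow up like [(1 - x)^(nu - 1)] at 1, so the integral is cut
    at distance [1/s] from it: two integrations by parts to the left, length times supremum to the
    right, each of order [s^(-nu-1)]. The condition [p 0 * u 0 = 0] removes a boundary term of order
    [1/s], which would be too large for [nu > 0]. *)
Lemma oscillation_le_cut (p p1 p2 u v : R -> R) nu s :
  0 <= nu <= 1 -> 1 <= s ->
  continuous (fun x => p x * v x) ->
  (forall x : R, 0 <= x < 1 -> is_derive x 1 p (p1 x)) ->
  (forall x : R, 0 <= x < 1 -> is_derive x 1 p1 (p2 x)) ->
  (forall x : R, 0 < x < 1 -> p2 x <= 0) ->
  (forall x : R, is_derive x 1 u (s * v x)) ->
  (forall x : R, is_derive x 1 v (- (s * u x))) ->
  (forall x, `|u x| <= 1) -> (forall x, `|v x| <= 1) ->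
  p 0 * u 0 = 0 -> (forall x, 0 <= x <= 1 -> `|p x| <= bump nu x) ->
  `|p1 0| <= 1 ->
  `|p1 (1 - s^-1)| <= 1 + 2 * bump (nu - 1) (1 - s^-1) ->
  `|\int[mu]_(x in `[0, 1]) (p x * v x)| <= 12 * (s `^ (- nu) / s).
Proof.
move=> nu01 s1 cpv dp dp1 p20 du dv u1 v1 pu0 ppw p10 p1r.
have /andP[nu0 nu1] := nu01.
have s0 : 0 < s by lra.
have sV : 0 < s^-1 by rewrite invr_gt0.
have sV1 : s^-1 <= 1 by rewrite invf_le1.
set r := 1 - s^-1 in p1r *; set q := s `^ (- nu).
have r0 : 0 <= r by rewrite /r; lra.
have r1 : r < 1 by rewrite /r; lra.
have q0 : 0 < q by rewrite powR_gt0.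
(* This is [s^(1 - nu) >= 1]; it absorbs the constants 1 in the bounds on [p1]. *)
have sq1 : 1 <= s * q.
  rewrite -[X in X * _](@powRr1 _ s) ?(ltW s0)// -powRD ?(gt_eqF s0) ?implybT//.
  by rewrite -[leLHS](powRr0 s) ler_powR//; lra.
have prle : `|p r| <= 2 * q.
  rewrite (le_trans (ppw _ _))//; first by rewrite r0 ltW.
  by rewrite bump_le_cut// lexx ltW.
have p1rle : `|p1 r| <= 3 * (s * q).
  by rewrite (le_trans p1r)//; have := bump_pred_le_cut nu1 s1; rewrite -/r -/q; lra.
rewrite (@Rintegral_itv_split _ 0 r 1) ?(ltW r1)//.
rewrite (le_trans (ler_normD _ _))//.
(* 12 = 2 + 8 + 2: boundary value of [p] at [r], boundary values of [p1], and the piece [[r, 1]]. *)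
have -> : 12 * (q / s) = (2 * q + 0) / s + 2 * (3 * (s * q) + s * q) / s ^+ 2 + 2 * q * s^-1.
  by field; rewrite gt_eqF.
apply: lerD.
  apply: le_trans (@concave_oscillation _ p p1 p2 u v r s _ _ _ _ _ _ _ _ _ _) _ => //.
  - by move=> x /andP[x0 xr]; apply: dp; rewrite x0 (le_lt_trans xr).
  - by move=> x /andP[x0 xr]; apply: dp1; rewrite x0 (le_lt_trans xr).
  - by move=> x /andP[x0 xr]; apply: p20; rewrite x0 (lt_trans xr).
  rewrite pu0 normr0; apply: lerD.
    by apply: ler_wpM2r; rewrite ?(ltW sV)// lerD2r.
  apply: ler_wpM2r; first by rewrite invr_ge0 sqr_ge0.
  by rewrite ler_pM2l// lerD// (le_trans p10).
apply: le_trans (le_normr_Rintegral _ _) _ => //.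
  exact: continuous_itv_integrable.
apply: (@le_trans _ _ (\int[mu]_(y in `[r, 1]) (2 * q))).
  apply: le_Rintegral => //.
  - by apply: continuous_itv_integrable => y; apply: cvg_norm; exact: cpv.
  - by apply: continuous_itv_integrable; exact: continuous_cst_fun.
  - move=> y; rewrite /= in_itv/= => /andP[ry y1].
    rewrite normrM -[leRHS]mulr1 ler_pM//.
    rewrite (le_trans (ppw _ _))//; first by rewrite (le_trans r0 ry).
    by rewrite bump_le_cut// ry.
rewrite Rintegral_cst//= lebesgue_measure_itv/= lte_fin r1/=.
by rewrite /r; have -> : 1 - (1 - s^-1) = s^-1 by ring.
Qed.

(** For [0 <= nu <= 1] the bump is concave: both terms of its second derivative are nonpositive. The
    primitive of the cosine is a sine, which kills the boundary term at 0. *)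
Lemma cosT_small nu s : 0 <= nu <= 1 -> 1 <= s ->
  `|cosT nu s| <= 12 * (s `^ (- nu) / s).
Proof.
move=> nu01 s1; have /andP[nu0 nu1] := nu01.
have s0 : 0 < s by lra.
have sV : 0 < s^-1 by rewrite invr_gt0.
have sV1 : s^-1 <= 1 by rewrite invf_le1.
apply: (@oscillation_le_cut (bump nu) (fun y => - (2 * nu) * y * bump (nu - 1) y)
  (fun y => - (2 * nu) * bump (nu - 1) y
    + 4 * nu * (nu - 1) * y ^+ 2 * bump (nu - 1 - 1) y)
  (fun y => sin (s * y)) (fun y => cos (s * y))).
- exact: nu01.
- exact: s1.
- exact: continuous_cosT_integrand.
- by move=> x /andP[? ?]; apply: is_derive_bump; apply/andP; lra.
- move=> x /andP[? ?]; have x1 : -1 < x < 1 by apply/andP; lra.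
  have h := is_derive_bump (nu - 1) x1.
  by apply: is_derive_eq; rewrite /GRing.scale/=; ring.
- move=> x /andP[x0 x1]; have := bump_ge0 (nu - 1) x; have := bump_ge0 (nu - 1 - 1) x.
  set A := bump _ _; set B := bump _ _ => A0 B0.
  have h1 : 0 <= nu * B by rewrite mulr_ge0.
  have h2 : 0 <= nu * (1 - nu) * (x ^+ 2 * A).
    by apply: mulr_ge0; apply: mulr_ge0 => //; rewrite ?subr_ge0 ?sqr_ge0.
  by lra.
- by move=> x; rewrite sin_max.
- by move=> x; rewrite cos_max.
- by rewrite mulr0 sin0 mulr0.
- by move=> x _; rewrite ger0_norm ?bump_ge0.
- by rewrite mulr0 mul0r normr0.
- have := bump_ge0 (nu - 1) (1 - s^-1); set B := bump _ _ => B0.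
  rewrite mulNr mulNr normrN ger0_norm; last by rewrite !mulr_ge0//; lra.
  have h : nu * (1 - s^-1) <= 1 by nra.
  by nra.
Qed.

(** Here the primitive [- cos] does not vanish at 0, but the amplitude [y * bump nu y] does, and it
    is again concave. Through [sin_moment_pred] this bound serves the orders between 1 and 2. *)
Lemma sin_moment_small nu s : 0 <= nu <= 1 -> 1 <= s ->
  `|sin_moment nu s| <= 12 * (s `^ (- nu) / s).
Proof.
move=> nu01 s1; have /andP[nu0 nu1] := nu01.
have s0 : 0 < s by lra.
have sV : 0 < s^-1 by rewrite invr_gt0.
have sV1 : s^-1 <= 1 by rewrite invf_le1.
apply: (@oscillation_le_cut (fun y => y * bump nu y)
  (fun y => bump nu y - (2 * nu) * y ^+ 2 * bump (nu - 1) y)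
  (fun y => - (6 * nu) * y * bump (nu - 1) y
    + 4 * nu * (nu - 1) * y ^+ 3 * bump (nu - 1 - 1) y)
  (fun y => - cos (s * y)) (fun y => sin (s * y))).
- exact: nu01.
- exact: s1.
- exact: continuous_sin_moment_integrand.
- move=> x /andP[? ?]; have x1 : -1 < x < 1 by apply/andP; lra.
  have h := is_derive_bump nu x1.
  by apply: is_derive_eq; rewrite /GRing.scale/=; ring.
- move=> x /andP[? ?]; have x1 : -1 < x < 1 by apply/andP; lra.
  have h := is_derive_bump nu x1.
  have h' := is_derive_bump (nu - 1) x1.
  by apply: is_derive_eq; rewrite /GRing.scale/=; ring.
- move=> x /andP[x0 x1]; have := bump_ge0 (nu - 1) x; have := bump_ge0 (nu - 1 - 1) x.
  set A := bump _ _; set B := bump _ _ => A0 B0.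
  have h1 : 0 <= nu * x * B by rewrite !mulr_ge0// ltW.
  have h2 : 0 <= nu * (1 - nu) * (x ^+ 3 * A).
    by apply: mulr_ge0; apply: mulr_ge0 => //; rewrite ?subr_ge0 ?exprn_ge0// ltW.
  by lra.
- by move=> x; apply: is_derive_eq; rewrite /GRing.scale/=; ring.
- by move=> x; apply: is_derive_eq; rewrite /GRing.scale/=; ring.
- by move=> x; rewrite normrN cos_max.
- by move=> x; rewrite sin_max.
- by rewrite !mul0r.
- move=> x /andP[x0 x1]; rewrite normrM !ger0_norm ?bump_ge0//.
  by rewrite ler_piMl ?bump_ge0.
- by rewrite expr0n/= mulr0 mul0r subr0 ger0_norm ?bump_ge0 ?bump_le1.
- have := bump_ge0 (nu - 1) (1 - s^-1); set B := bump (nu - 1) _ => B0.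
  rewrite (le_trans (ler_normB _ _))// ger0_norm ?bump_ge0// lerD ?bump_le1//.
  rewrite ger0_norm; last by rewrite !mulr_ge0 ?sqr_ge0//; lra.
  have h : nu * (1 - s^-1) ^+ 2 <= 1 by rewrite mulr_ile1// ?sqr_ge0// expr_le1//; lra.
  by nra.
Qed.

End SmallOrder.

(** * Stirling-type majorant and the energy argument *)

Section Stirling.
Variable R : realType.
Implicit Types (nu x y : R).

(** The Padé bound is chosen for its exactness at [y = 1/x], where it equals [1 / (x + 1/2)]; this
    is precisely what the exponent [x + 1/2] in [stirling_step] calls for. *)
Lemma ln1D_ge y : 0 <= y -> 2 * y / (2 + y) <= ln (1 + y).
Proof.
rewrite le_eqVlt => /predU1P[<-|y0]; first by rewrite mulr0 mul0r addr0 ln1.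
pose f x := ln (1 + x) - 2 * x * (2 + x)^-1.
pose df x := x ^+ 2 / ((1 + x) * (2 + x) ^+ 2).
have dfP x : 0 <= x -> is_derive x 1 f (df x).
  move=> x0.
  have h1 : is_derive x 1 (fun x => ln (1 + x)) (1 + x)^-1.
    have x1 : 0 < 1 + x by lra.
    have h := @is_derive1_comp _ (@ln R) (fun x => 1 + x) x _ _ (is_derive1_ln x1) (is_deriveD _ _).
    by apply: is_derive_eq; rewrite /GRing.scale/=; ring.
  have x2 : 2 + x != 0 by rewrite gt_eqF//; lra.
  have h2 : is_derive x 1 (fun x => (2 + x)^-1) (- (2 + x) ^- 2).
    have h := @is_deriveV _ (fun x => 2 + x) x _ 1 x2 (is_deriveD _ _).
    by apply: is_derive_eq; rewrite /GRing.scale/=; ring.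
  apply: is_derive_eq; rewrite /df /GRing.scale/=; field.
  by rewrite x2 gt_eqF//; lra.
have [] := @MVT R f df 0 y y0.
- by move=> x; rewrite in_itv/= => /andP[x0 _]; exact/dfP/ltW.
- apply: derivable_within_continuous => x; rewrite in_itv/= => /andP[/dfP h _].
  exact: ex_derive.
- move=> c; rewrite in_itv/= => /andP[c0 _].
  rewrite {2}/f mulr0 mul0r addr0 ln1 !subr0 => e.
  rewrite -subr_ge0 -/(f y) e mulr_ge0 ?(ltW y0)// divr_ge0 ?sqr_ge0//.
  by rewrite mulr_ge0 ?sqr_ge0//; lra.
Qed.

(* Stirling-type majorant of [2^nu Gamma (nu + 1)]. *)
Definition stirling nu := 2 `^ nu * expR (- nu) * (nu + 1) `^ (nu + 1 / 2).

Lemma stirling_gt0 nu : 0 <= nu -> 0 < stirling nu.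
Proof.
by move=> nu0; rewrite /stirling !mulr_gt0 ?powR_gt0 ?expR_gt0// ltr_wpDl.
Qed.

(** With [x = nu + 1] it reduces to [e x^(x + 1/2) <= (x + 1)^(x + 1/2)], that is
    [1 <= (x + 1/2) ln (1 + 1/x)]. The majorant thus outgrows the factor [2 (nu + 1)] produced by
    raising the order by one. *)
Lemma stirling_step nu : 0 <= nu -> 2 * (nu + 1) * stirling nu <= stirling (nu + 1).
Proof.
move=> nu0; set x := nu + 1; have x0 : 0 < x by rewrite /x; lra.
have x1 : 0 < x + 1 by lra.
have key : expR 1 * x `^ (x + 1 / 2) <= (x + 1) `^ (x + 1 / 2).
  have -> : x + 1 = x * (1 + x^-1) by rewrite mulrDr mulr1 mulfV ?gt_eqF.
  have y0 : 0 < x^-1 by rewrite invr_gt0.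
  rewrite powRM ?(ltW x0)//; last by lra.
  rewrite mulrC ler_wpM2l ?powR_ge0// /powR gt_eqF ?ler_expR; last by lra.
  apply: le_trans (ler_wpM2l _ (ln1D_ge (ltW y0))); last by lra.
  rewrite -subr_ge0; set e := (X in 0 <= X); suff -> : e = 0 by [].
  by rewrite /e; field; rewrite ?gt_eqF//; lra.
have -> : stirling (x) = 2 * (2 `^ nu * expR (- nu)) * (expR (- 1) * (x + 1) `^ (x + 1 / 2)).
  rewrite /stirling {1 2}/x opprD expRD powRD; last by rewrite pnatr_eq0 implybT.
  by rewrite powRr1//; ring.
have -> : 2 * x * stirling nu = 2 * (2 `^ nu * expR (- nu)) * x `^ (x + 1 / 2).
  rewrite /stirling -/x; have -> : x + 1 / 2 = (nu + 1 / 2) + 1 by rewrite /x; ring.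
  rewrite [in RHS]powRD; last by rewrite (gt_eqF x0) implybT.
  by rewrite powRr1 ?(ltW x0)//; ring.
apply: ler_wpM2l; first by rewrite !mulr_ge0 ?powR_ge0 ?expR_ge0.
by rewrite expRN [leRHS]mulrC ler_pdivlMr ?expR_gt0// mulrC.
Qed.

Lemma stirling_ge nu : 0 <= nu <= 2 -> expR (- 2) <= stirling nu.
Proof.
move=> /andP[nu0 nu2]; rewrite /stirling.
have h1 : 1 <= 2 `^ nu by rewrite -[leLHS](powRr0 2) ler_powR// ler1n.
have h2 : expR (- 2) <= expR (- nu) by rewrite ler_expR; lra.
have h3 : 1 <= (nu + 1) `^ (nu + 1 / 2).
  by rewrite -[leLHS](powRr0 (nu + 1)) ler_powR//; lra.
rewrite -[leLHS]mul1r -[leLHS]mulr1; apply: ler_pM => //.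
by apply: ler_pM => //; rewrite expR_ge0.
Qed.

End Stirling.

(** * Uniform bound on the scaled transform, by recurrence at infinity and energy *)

Section UniformBound.
Variable R : realType.
Implicit Types (nu s d K : R).

Definition scosT nu s := s `^ (nu + 1) * cosT nu s.

Lemma powR_succ s nu : 0 < s -> s `^ (nu + 1) = s `^ nu * s.
Proof.
by move=> s0; rewrite powRD ?powRr1 ?(ltW s0)// (gt_eqF s0) implybT.
Qed.

(** Order at most 1 gives 12 directly. Between 1 and 2, [sin_moment_pred] lowers the order by one
    and costs a factor [2 nu], whence [24 nu <= 48]. A base range of length 2 is what a recurrence
    reaching back two orders requires. *)
Lemma scosT_small nu s : 0 <= nu <= 2 -> 1 <= s -> `|scosT nu s| <= 48.
Proof.
move=> /andP[nu0 nu2] s1; have s0 : 0 < s by lra.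
have sn : s != 0 by rewrite gt_eqF.
rewrite /scosT normrM ger0_norm ?powR_ge0//.
have [nu1|nu1] := leP nu 1.
  apply: (@le_trans _ _ (s `^ (nu + 1) * (12 * (s `^ (- nu) / s)))).
    by rewrite ler_wpM2l ?powR_ge0// cosT_small// nu0.
  rewrite powR_succ// powRN.
  have -> : s `^ nu * s * (12 * ((s `^ nu)^-1 / s)) = 12.
    by field; rewrite sn gt_eqF// powR_gt0.
  by lra.
have e : cosT nu s = 2 * nu * sin_moment (nu - 1) s / s.
  by rewrite sin_moment_pred ?ltW// mulrC mulKf.
have nu1' : 0 <= nu - 1 <= 1 by apply/andP; lra.
have h := sin_moment_small nu1' s1.
rewrite e normrM normrM (ger0_norm (_ : 0 <= 2 * nu))//; last by lra.
rewrite (ger0_norm (_ : 0 <= s^-1)) ?invr_ge0 ?(ltW s0)//.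
apply: (@le_trans _ _ (s `^ (nu + 1) * (2 * nu * (12 * (s `^ (- (nu - 1)) / s)) / s))).
  rewrite ler_wpM2l ?powR_ge0// ler_wpM2r ?invr_ge0 ?(ltW s0)//.
  by rewrite ler_wpM2l//; lra.
rewrite -{1}[nu](subrK 1) !powR_succ// powRN.
set q := s `^ (nu - 1); have q0 : 0 < q by rewrite powR_gt0.
have -> : q * s * s * (2 * nu * (12 * (q^-1 / s)) / s) = 24 * nu.
  by field; rewrite sn gt_eqF.
by lra.
Qed.

Lemma scosT_rec nu s : 1 <= nu -> 0 < s -> scosT (nu + 1) s =
  2 * (nu + 1) * ((2 * nu + 1) / s * scosT nu s - 2 * nu * scosT (nu - 1) s).
Proof.
move=> nu1 s0; rewrite /scosT subrK !powR_succ//.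
transitivity (s `^ nu * (s ^+ 2 * cosT (nu + 1) s)); first by ring.
by rewrite cosT_rec//; field; rewrite gt_eqF.
Qed.

(* The factor [(2 nu - 1) / s] makes the order [nu - 1] term negligible, so the
   recurrence transports a bound at infinity from order [nu - 2] to order [nu]. *)
Lemma rec_step_bound nu s K d (x y m0 m1 m2 : R) : 2 < nu -> 0 < s -> 0 < K -> 0 < d ->
  0 <= m0 -> 0 <= m1 -> 0 <= m2 ->
  2 * (2 * nu - 1) * (K + 1) / d <= s ->
  `|x| <= (K + 1) * m1 -> `|y| <= (K + d / 2) * m2 ->
  2 * nu * m1 <= m0 -> 2 * (nu - 1) * m2 <= m1 ->
  `|2 * nu * ((2 * (nu - 1) + 1) / s * x - 2 * (nu - 1) * y)| <= (K + d) * m0.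
Proof.
move=> nu2 s0 K0 d0 m00 m10 m20 ss hx hy m1m0 m2m1.
have n0 : 0 <= 2 * nu by lra.
have nm : 0 <= 2 * (nu - 1) by lra.
have k0 : 0 <= K + d / 2 by lra.
have t0 : 0 <= (2 * (nu - 1) + 1) / s by rewrite divr_ge0 ?(ltW s0)//; lra.
have c1 : (2 * (nu - 1) + 1) / s * (K + 1) <= d / 2.
  by rewrite mulrAC ler_pdivrMr//; move: ss; rewrite ler_pdivrMr//; lra.
set t := (2 * (nu - 1) + 1) / s in t0 c1 *.
rewrite normrM (ger0_norm n0).
have e1 : `|t * x - 2 * (nu - 1) * y| <= t * `|x| + 2 * (nu - 1) * `|y|.
  rewrite (le_trans (ler_normB _ _))// (normrM t) (ger0_norm t0).
  by rewrite (normrM (2 * (nu - 1))) (ger0_norm nm).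
apply: (le_trans (ler_wpM2l n0 e1)); rewrite mulrDr.
have -> : (K + d) * m0 = d / 2 * m0 + (K + d / 2) * m0 by field.
apply: lerD.
  apply: (@le_trans _ _ (t * (K + 1) * (2 * nu * m1))).
    have -> : t * (K + 1) * (2 * nu * m1) = 2 * nu * (t * ((K + 1) * m1)) by ring.
    by rewrite ler_wpM2l// ler_wpM2l.
  by apply: ler_pM => //; rewrite mulr_ge0//; lra.
apply: (@le_trans _ _ ((K + d / 2) * (2 * nu * (2 * (nu - 1) * m2)))).
  have -> : (K + d / 2) * (2 * nu * (2 * (nu - 1) * m2)) =
    2 * nu * (2 * (nu - 1) * ((K + d / 2) * m2)) by ring.
  by rewrite ler_wpM2l// ler_wpM2l.
by rewrite ler_wpM2l// (le_trans _ m1m0)// ler_wpM2l.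
Qed.

Lemma stirling_pred nu : 1 <= nu -> 2 * nu * stirling (nu - 1) <= stirling nu.
Proof.
by move=> nu1; have := @stirling_step _ (nu - 1); rewrite subrK subr_ge0; exact.
Qed.

(** The threshold [S] is uncontrolled in [nu], but [K] must not deteriorate with the number of
    steps. Hence the slack [d]: order [nu - 2] is used with slack [d / 2], and order [nu - 1],
    damped by [1/s], fills the other half. The orders are real, so the induction is on the length of
    the range [[0, n + 2]]. *)
Lemma scosT_eventually K nu : 0 < K -> (forall nu, 0 <= nu <= 2 -> 48 <= K * stirling nu) ->
  0 <= nu -> forall d, 0 < d ->
  exists2 S, 1 <= S & forall s, S <= s -> `|scosT nu s| <= (K + d) * stirling nu.
Proof.
move=> K0 KM.
have small nu' s d : 0 <= nu' <= 2 -> 1 <= s -> 0 < d ->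
    `|scosT nu' s| <= (K + d) * stirling nu'.
  move=> nu02 s1 d0; have /andP[nu0' _] := nu02.
  apply: (le_trans (scosT_small nu02 s1)); apply: (le_trans (KM _ nu02)).
  by rewrite ler_wpM2r ?(ltW (stirling_gt0 nu0'))// lerDl ltW.
have H n : forall nu, 0 <= nu <= n%:R + 2 -> forall d, 0 < d ->
  exists2 S, 1 <= S & forall s, S <= s -> `|scosT nu s| <= (K + d) * stirling nu.
  elim: n => [{}nu|n IH {}nu /andP[nu0 nun] d].
    by rewrite add0r => nu02 d d0; exists 1 => // s s1; exact: small.
  move=> d0; have [nu1|nu1] := leP nu 2.
    by exists 1 => // s s1; apply: small => //; rewrite nu0.
  have nE : n.+1%:R = n%:R + 1 :> R by rewrite natr1.
  have r1 : 0 <= nu - 1 <= n%:R + 2 by apply/andP; lra.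
  have d20 : 0 < d / 2 by lra.
  have r2 : 0 <= nu - 1 - 1 <= n%:R + 2 by apply/andP; lra.
  have nu1' : 1 <= nu by lra.
  have nu1'' : 1 <= nu - 1 by lra.
  have [S1 S11 H1] := IH _ r1 _ ltr01.
  have [S2 S21 H2] := IH _ r2 _ d20.
  (* The third entry makes the damped term of order [nu - 1] at most [d / 2] times the majorant. *)
  exists (Num.max S1 (Num.max S2 (2 * (2 * nu - 1) * (K + 1) / d))).
    by rewrite le_max S11.
  move=> s; rewrite !ge_max => /and3P[sS1 sS2 s3].
  have s0 : 0 < s by rewrite (lt_le_trans _ (le_trans S11 sS1)).
  rewrite -{1}(subrK 1 nu) scosT_rec// subrK.
  have /andP[p1 _] := r1; have /andP[p2 _] := r2.
  apply: (rec_step_bound nu1 s0 K0 d0 _ _ _ s3 (H1 _ sS1) (H2 _ sS2)).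
  - exact/ltW/stirling_gt0.
  - exact/ltW/stirling_gt0.
  - exact/ltW/stirling_gt0.
  - exact: stirling_pred.
  - exact: stirling_pred.
move=> nu0; apply: (H (Num.bound nu)).
by rewrite nu0 (le_trans (ltW (archi_boundP nu0)))// lerDl.
Qed.

Lemma is_derive_scosT nu s : 0 <= nu -> 0 < s -> is_derive s 1 (scosT nu)
  ((nu + 1) * s `^ nu * cosT nu s - s `^ (nu + 1) * sin_moment nu s).
Proof.
move=> nu0 s0; have h1 := is_derive1_powR (nu + 1) s0.
have h2 := is_derive_cosT s nu0.
by apply: is_derive_eq; rewrite addrK /GRing.scale/=; ring.
Qed.

(** With [a = 2 nu W (nu-1)], [b = W nu] and [t = nu/s], the quadratic form [a^2 + b^2 - 2 t a b]
    has [s]-derivative [2 (nu/s^2) a b]. Since [1 - t] has derivative [nu/s^2], the product has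
    derivative [nu/s^2] times [(a + b)^2 - 4 t a b]. *)
Definition energy nu s := (1 - nu / s) *
  ((2 * nu * scosT (nu - 1) s) ^+ 2 + scosT nu s ^+ 2
   - 2 * (nu / s) * (2 * nu * scosT (nu - 1) s * scosT nu s)).

Lemma is_derive_energy nu s : 1 <= nu -> 0 < s -> is_derive s 1 (energy nu)
  (nu / s ^+ 2 * ((2 * nu * scosT (nu - 1) s + scosT nu s) ^+ 2
    - 4 * (nu / s) * (2 * nu * scosT (nu - 1) s * scosT nu s))).
Proof.
move=> nu1 s0; have sn : s != 0 by rewrite gt_eqF.
have h1 : is_derive s 1 (scosT (nu - 1)) (nu / s * scosT (nu - 1) s - scosT nu s / (2 * nu)).
  have nu10 : 0 <= nu - 1 by lra.
  have h := is_derive_scosT nu10 s0.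
  apply: is_derive_eq; rewrite /scosT subrK.
  have e : sin_moment (nu - 1) s = s * cosT nu s / (2 * nu).
    by rewrite -sin_moment_pred// mulrC mulKf// gt_eqF//; lra.
  have e' : s `^ nu = s `^ (nu - 1) * s by rewrite -powR_succ// subrK.
  rewrite e powR_succ// e'.
  by field; rewrite sn gt_eqF//; lra.
have h2 : is_derive s 1 (scosT nu) (2 * nu * scosT (nu - 1) s - nu / s * scosT nu s).
  have nu0 : 0 <= nu by lra.
  have h := is_derive_scosT nu0 s0.
  apply: is_derive_eq; rewrite /scosT subrK.
  transitivity ((nu + 1) * s `^ nu * cosT nu s - s `^ nu * (s * sin_moment nu s)).
    by rewrite powR_succ//; ring.
  rewrite sin_moment_rec// powR_succ//.
  by field.
have h3 : is_derive s 1 (fun x => x^-1) (- s ^- 2).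
  have h := @is_deriveV _ (fun x => x) s _ 1 sn (is_derive_id _ _).
  by apply: is_derive_eq; rewrite /GRing.scale/=; ring.
have nu0 : nu != 0 by rewrite gt_eqF//; lra.
apply: is_derive_eq; rewrite /GRing.scale/=.
move: (scosT nu s) (scosT (nu - 1) s) => b a.
by field; rewrite sn nu0.
Qed.

Lemma energy_nondecreasing nu s S : 1 <= nu -> nu <= s -> s <= S ->
  energy nu s <= energy nu S.
Proof.
move=> nu1 nus; rewrite le_eqVlt => /predU1P[->//|sS].
pose dE x := nu / x ^+ 2 * ((2 * nu * scosT (nu - 1) x + scosT nu x) ^+ 2
    - 4 * (nu / x) * (2 * nu * scosT (nu - 1) x * scosT nu x)).
have [] := @MVT R (energy nu) dE s S sS.
- by move=> x; rewrite in_itv/= => /andP[? _]; apply: is_derive_energy => //; lra.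
- apply: derivable_within_continuous => x; rewrite in_itv/= => /andP[sx _].
  have x0 : 0 < x by lra.
  by have h := is_derive_energy nu1 x0; exact: ex_derive.
- move=> c; rewrite in_itv/= => /andP[sc _] e; rewrite -subr_ge0 e.
  have c0 : 0 < c by lra.
  rewrite mulr_ge0 ?subr_ge0 ?(ltW sS)// /dE mulr_ge0 ?divr_ge0 ?sqr_ge0//; first by lra.
  set t := nu / c; set a := 2 * nu * _; set b := scosT nu c.
  have t0 : 0 <= t by rewrite divr_ge0//; lra.
  have t1 : t <= 1 by rewrite ler_pdivrMr//; lra.
  (* A convex combination of two squares, as [t <= 1] on [c >= nu]. *)
  have -> : (a + b) ^+ 2 - 4 * t * (a * b) =
    (1 - t) * (a + b) ^+ 2 + t * (a - b) ^+ 2 by ring.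
  by rewrite addr_ge0// mulr_ge0 ?sqr_ge0// subr_ge0.
Qed.

(** The form with parameter [t] is at least [(1 - t) (a^2 + b^2)], and the weight supplies a second
    [1 - t >= 1/2]; on the other side the energy is at most [A^2 + B^2 <= 2 k^2]. So [b^2 <= 8 k^2],
    rounded up to [9 k^2]. *)
Lemma energy_compare (a b A B t T k : R) : 0 <= t <= 1 / 2 -> 0 <= T <= 1 / 2 ->
  `|A| <= k -> `|B| <= k ->
  (1 - t) * (a ^+ 2 + b ^+ 2 - 2 * t * (a * b)) <=
    (1 - T) * (A ^+ 2 + B ^+ 2 - 2 * T * (A * B)) ->
  `|b| <= 3 * k.
Proof.
move=> /andP[t0 t1] /andP[T0 T1] Ak Bk E.
have k0 : 0 <= k := le_trans (normr_ge0 _) Ak.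
have A2 : A ^+ 2 <= k ^+ 2 by rewrite -(real_normK (num_real A)) lerXn2r ?nnegrE.
have B2 : B ^+ 2 <= k ^+ 2 by rewrite -(real_normK (num_real B)) lerXn2r ?nnegrE.
have lo : (1 - t) ^+ 2 * (a ^+ 2 + b ^+ 2) <=
    (1 - t) * (a ^+ 2 + b ^+ 2 - 2 * t * (a * b)).
  rewrite -subr_ge0.
  have -> : (1 - t) * (a ^+ 2 + b ^+ 2 - 2 * t * (a * b))
    - (1 - t) ^+ 2 * (a ^+ 2 + b ^+ 2) = (1 - t) * (t * (a - b) ^+ 2) by ring.
  by apply: mulr_ge0; [lra|apply: mulr_ge0 => //; exact: sqr_ge0].
have hi : (1 - T) * (A ^+ 2 + B ^+ 2 - 2 * T * (A * B)) <= A ^+ 2 + B ^+ 2.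
  rewrite -subr_ge0.
  have -> : A ^+ 2 + B ^+ 2 - (1 - T) * (A ^+ 2 + B ^+ 2 - 2 * T * (A * B)) =
    T * ((1 - T) * (A + B) ^+ 2 + T * (A ^+ 2 + B ^+ 2)) by ring.
  apply: mulr_ge0 => //; apply: addr_ge0; apply: mulr_ge0 => //; first by lra.
    exact: sqr_ge0.
  by apply: addr_ge0; exact: sqr_ge0.
have q : 1 / 4 <= (1 - t) ^+ 2 by nra.
have b2 : b ^+ 2 <= (3 * k) ^+ 2.
  have : 1 / 4 * (a ^+ 2 + b ^+ 2) <= (1 - t) ^+ 2 * (a ^+ 2 + b ^+ 2).
    by apply: ler_wpM2r => //; apply: addr_ge0; exact: sqr_ge0.
  by have := sqr_ge0 a; have := sqr_ge0 k; lra.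
by rewrite -(@ler_pXn2r _ 2)// ?nnegrE ?mulr_ge0// real_normK ?num_real.
Qed.

(** For [nu > 1] the energy at [s] is compared with the energy at a remote [S]; it involves order
    [nu - 1], so [nu <= 1] is treated by the direct bounds, with [|cosT| <= 1] when [s < 1]. *)
Lemma scosT_bound : exists2 C : R, 0 < C & forall nu s, 0 <= nu -> 0 < s -> 2 * nu <= s ->
  `|scosT nu s| <= C * stirling nu.
Proof.
have [K K0 KM] : exists2 K, 0 < K & forall nu, 0 <= nu <= 2 -> 48 <= K * stirling nu.
  exists (48 * expR 2); first by rewrite mulr_gt0// expR_gt0.
  move=> nu nu02; have := stirling_ge nu02; rewrite expRN => h.
  by rewrite -mulrA ler_peMr// mulrC -ler_pdivrMr ?expR_gt0// mul1r.
have K1 : 0 <= K + 1 by lra.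
exists (3 * (K + 1)); first by lra.
move=> nu s nu0 s0 nus; have M0 := stirling_gt0 nu0.
have [nu1|nu1] := leP nu 1.
  have nu02 : 0 <= nu <= 2 by apply/andP; lra.
  have big : K * stirling nu <= 3 * (K + 1) * stirling nu by rewrite ler_wpM2r ?(ltW M0)//; lra.
  apply: le_trans big; apply: le_trans (KM _ nu02).
  have [s1|s1] := leP 1 s; first exact: scosT_small.
  have p1 : s `^ (nu + 1) <= 1.
    by rewrite -[leRHS](powRr0 s) ger_powR ?s0 ?(ltW s1) ?addr_ge0.
  rewrite /scosT normrM (ger0_norm (powR_ge0 _ _)).
  apply: (@le_trans _ _ 1); last by rewrite ler1n.
  by rewrite mulr_ile1 ?powR_ge0 ?cosT_le1.
have nu10 : 0 <= nu - 1 by lra.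
have nu1' : 1 <= nu by lra.
have nus' : nu <= s by lra.
have n0 : 0 <= 2 * nu by lra.
have half S : s <= S -> 0 <= nu / S <= 1 / 2.
  move=> sS; have S0 : 0 < S by lra.
  by rewrite divr_ge0 ?(ltW S0)//= ler_pdivrMr//; lra.
have [S1 _ H1] := scosT_eventually K0 KM nu0 ltr01.
have [S2 _ H2] := scosT_eventually K0 KM nu10 ltr01.
(* Any point beyond [s] and both thresholds will do: [S] disappears from the conclusion. *)
pose S := Num.max s (Num.max S1 S2).
have sS : s <= S by rewrite le_max lexx.
have h1 : `|scosT nu S| <= (K + 1) * stirling nu by apply: H1; rewrite !le_max lexx orbT.
have h2 : `|scosT (nu - 1) S| <= (K + 1) * stirling (nu - 1).
  by apply: H2; rewrite !le_max lexx !orbT.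
have h3 : `|2 * nu * scosT (nu - 1) S| <= (K + 1) * stirling nu.
  rewrite normrM ger0_norm//; apply: (le_trans (ler_wpM2l n0 h2)).
  by rewrite mulrCA ler_wpM2l// stirling_pred.
rewrite -mulrA.
exact: (energy_compare (half _ (lexx s)) (half _ sS) h3 h1
  (energy_nondecreasing nu1' nus' sS)).
Qed.

End UniformBound.

(** * Affine changes of variable *)

Section Affine.
Variable R : realType.
Notation mu := (@lebesgue_measure R).
Implicit Types (a b : R).

Lemma measurable_affine a b :
  measurable_fun [set: measurableTypeR R] (fun x : R => a * x + b : measurableTypeR R).
Proof.
by apply: measurable_funD => //; apply: measurable_funM.
Qed.

(** By uniqueness of Lebesgue measure it suffices to compare the two measures on the half-open
    intervals []u, v]]. *)
Lemma lebesgue_measure_affine a b (A : set R) : a != 0 -> measurable A ->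
  mu A = (`|a|%:E * pushforward mu (fun x : R => a * x + b)%R A)%E.
Proof.
move=> a0 mA; pose k := NngNum (normr_ge0 a).
have U := @lebesgue_measure_unique R (mscale k (pushforward mu
  (fun x : measurableTypeR R => a * x + b : measurableTypeR R))).
apply: (U (measurable_affine a b) _ _ mA) => {U A mA}.
move=> _ [[u v] _ <-] /=.
rewrite -[RHS]/(`|a|%:E * mu ((fun x : R => a * x + b)%R @^-1` `]u, v]))%E.
have [uv|vu] := ltP u v; last first.
  have E : `]u, v]%classic = set0 :> set R by rewrite set_itv_ge// bnd_simp -leNgt.
  by rewrite E preimage_set0 !measure0 mule0.
have [a_gt0|a_lt0] : 0 < a \/ a < 0.
  by move: a0; rewrite neq_lt => /orP[]; [right|left].
- have -> : (fun x => a * x + b) @^-1` `]u, v] = `](u - b) / a, (v - b) / a]%classic.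
    apply/seteqP; split=> x /=; rewrite !in_itv/= ltr_pdivrMr// ler_pdivlMr//;
      by move=> /andP[? ?]; apply/andP; lra.
  rewrite !lebesgue_measure_itv/= !lte_fin uv ltr_pM2r ?invr_gt0// ltrD2r uv.
  rewrite -!EFinB -EFinM (gtr0_norm a_gt0); congr EFin.
  by field; rewrite gt_eqF.
(* A negative slope exchanges the open and the closed end. *)
- have -> : (fun x => a * x + b) @^-1` `]u, v] = `[(v - b) / a, (u - b) / a[%classic.
    apply/seteqP; split=> x /=; rewrite !in_itv/= ltr_ndivlMr// ler_ndivrMr//;
      by move=> /andP[? ?]; apply/andP; lra.
  rewrite !lebesgue_measure_itv/= !lte_fin uv ltr_nM2r ?invr_lt0// ltrD2r uv.
  rewrite -!EFinB -EFinM (ltr0_norm a_lt0); congr EFin.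
  by field; rewrite lt_eqF.
Qed.

Lemma ge0_integral_affine a b (f : R -> \bar R) : a != 0 ->
  measurable_fun setT f -> (forall x, 0 <= f x)%E ->
  (\int[mu]_x f x = `|a|%:E * \int[mu]_x f (a * x + b)%R)%E.
Proof.
move=> a0 mf f0.
have f0' : {in [set: R], forall y, (0 <= f y)%E} by move=> y _.
have := @ge0_integral_pushforward _ _ _ _ R _ (measurable_affine a b) mu setT f
  measurableT mf f0'.
rewrite preimage_setT /= => <-.
rewrite -(@ge0_integral_mscale _ _ _ _ _ _ (NngNum (normr_ge0 a)))//.
  exact: measurable_affine.
move=> mphi; apply: eq_measure_integral => A mA _.
exact: lebesgue_measure_affine.
Qed.

Lemma integrable_affine a b (f : R -> R) : a != 0 ->
  mu.-integrable setT (EFin \o f) -> mu.-integrable setT (EFin \o (fun x => f (a * x + b))).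
Proof.
move=> a0 /integrableP[mf foo]; apply/integrableP; split.
  exact: (measurableT_comp mf (measurable_affine a b)).
move: foo; rewrite (ge0_integral_affine b a0)//; last exact: measurableT_comp.
have na : 0 < `|a| by rewrite normr_gt0.
move=> h; rewrite -(@lte_pmul2l _ `|a|%:E)//.
by rewrite gt0_muley.
Qed.

Lemma Rintegral_affine a b (f : R -> R) : a != 0 ->
  mu.-integrable setT (EFin \o f) ->
  \int[mu]_x f x = `|a| * \int[mu]_x f (a * x + b).
Proof.
move=> a0 intf; have intg := integrable_affine b a0 intf.
have [mf _] := integrableP _ _ _ intf.
rewrite /Rintegral -[X in X * _]/(fine `|a|%:E) -fineM//; last first.
  exact: integrable_fin_num.
congr fine; rewrite integralE [in RHS]integralE.
rewrite muleBr//; last first.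
  apply: fin_num_adde_defl.
  by rewrite fin_numN; exact: integrable_neg_fin_num.
congr (_ - _)%E.
- rewrite (ge0_integral_affine b a0)//; last exact: measurable_funepos.
  by congr (_ * _)%E; apply: eq_integral => x _; rewrite !funeposE.
- rewrite (ge0_integral_affine b a0)//; last exact: measurable_funeneg.
  by congr (_ * _)%E; apply: eq_integral => x _; rewrite !funenegE.
Qed.

Lemma Rintegral_even (f : R -> R) : mu.-integrable setT (EFin \o f) ->
  (forall x, f (- x) = f x) ->
  \int[mu]_x f x = 2 * \int[mu]_(x in `[0, +oo[) f x.
Proof.
move=> intf fe.
have mI : measurable (`[0, +oo[%classic : set R) by [].
have mJ : measurable (`]-oo, 0[%classic : set R) by [].
have E : [set: R] = `[0, +oo[ `|` `]-oo, 0[.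
  apply/seteqP; split=> x //= _; rewrite !in_itv/= andbT.
  by case: (leP 0 x); [left|right].
have D : [disjoint `[0, +oo[%classic & (`]-oo, 0[%classic : set R)].
  apply/disj_setPS => x [] /=; rewrite !in_itv/= andbT => x0.
  by rewrite ltNge x0.
have restr (A : set R) : measurable A -> mu.-integrable setT (EFin \o (f \_ A)).
  move=> mA; rewrite -restrict_EFin; apply/integrable_restrict => //.
  by rewrite setTI; exact: integrableS intf.
rewrite {1}E Rintegral_setU//; last by rewrite -E.
rewrite mulr2n mulrDl mul1r; congr (_ + _).
(* The reflection of []-oo, 0[] is []0, +oo[], so the point 0 is dropped first. *)
rewrite -Rintegral_itv_obnd_cbnd; last exact: integrableS intf.
rewrite Rintegral_mkcond (@Rintegral_affine (-1) 0) ?oppr_eq0 ?oner_eq0//; last exact: restr.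
rewrite normrN1 mul1r [RHS]Rintegral_mkcond; apply: eq_Rintegral => x _.
rewrite mulN1r addr0 /patch; rewrite !mem_setE !in_itv/= oppr_lt0 andbT.
by case: ifP => // _; rewrite fe.
Qed.

End Affine.

(** * Beta-Gamma identity *)

Section BetaGamma.
Variable R : realType.
Notation mu := (@lebesgue_measure R).
Implicit Types (p t z y : R).

Definition gamma_fun p t := (Num.max t 0) `^ p * expR (- t).

Lemma gamma_fun_ge0 p t : 0 <= gamma_fun p t.
Proof. by rewrite mulr_ge0 ?powR_ge0 ?expR_ge0. Qed.

Lemma continuous_gamma_fun p : 0 <= p -> continuous (gamma_fun p).
Proof.
move=> p0 t; apply: cvgM; first exact: continuous_max0_powR.
apply: (@continuous_comp _ _ _ (fun t : R => - t) (@expR R)).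
  by apply: cvgN; exact: cvg_id.
exact: continuous_expR.
Qed.

Lemma measurable_gamma_fun p : 0 < p -> measurable_fun setT (gamma_fun p).
Proof.
move=> p0; apply: continuous_measurable_fun.
exact: continuous_gamma_fun (ltW p0).
Qed.

Lemma measurable_bump p : 0 < p -> measurable_fun setT (@bump R p).
Proof.
move=> p0; apply: continuous_measurable_fun.
exact: continuous_bump (ltW p0).
Qed.

Lemma measurable_max0_powR p : 0 <= p ->
  measurable_fun setT (fun x : R => (Num.max x 0) `^ p).
Proof.
by move=> p0; apply: continuous_measurable_fun; exact: continuous_max0_powR.
Qed.

(** A function of [(t, z)] whose two iterated integrals are the two sides of the Beta-Gamma
    identity: in [z], the scaling [z = sqrt t * y] produces [t^(p + 1/2)] and the bump; in [t], the
    shift by [z^2] splits off a Gaussian, whence [sqrt pi]. *)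
Definition beta_kernel p (w : R * R) := (Num.max (w.1 - w.2 ^+ 2) 0) `^ p * expR (- w.1).

Lemma measurable_beta_kernel p : 0 <= p ->
  measurable_fun [set: measurableTypeR R * measurableTypeR R] (beta_kernel p).
Proof.
move=> p0; apply: measurable_funM.
  apply: (@measurableT_comp _ _ _ _ _ _ (fun x : R => (Num.max x 0) `^ p)).
    exact: measurable_max0_powR.
  by apply: measurable_funB => //; apply: measurable_funX.
apply: (@measurableT_comp _ _ _ _ _ _ (@expR R)) => //.
exact: measurableT_comp.
Qed.

Lemma integral_beta_kernel1 p t : 0 < p ->
  (\int[mu]_z (beta_kernel p (t, z))%:E =
   (gamma_fun (p + 1 / 2) t)%:E * \int[mu]_y (bump p y)%:E)%E.
Proof.
move=> p0; have [t0|t0] := leP t 0.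
  rewrite /gamma_fun max_r// powR0 ?mul0r ?mul0e; last by rewrite gt_eqF//; lra.
  apply: integral0_eq => z _; rewrite /beta_kernel/= max_r ?powR0 ?mul0r ?gt_eqF//.
  by rewrite subr_le0 (le_trans t0)// sqr_ge0.
have st0 : 0 < Num.sqrt t by rewrite sqrtr_gt0.
rewrite (@ge0_integral_affine _ (Num.sqrt t) 0)//; last 3 first.
- by rewrite gt_eqF.
- apply/measurable_EFinP.
  exact: (measurableT_comp (measurable_beta_kernel (ltW p0)) (measurable_pair1 t)).
- by move=> z; rewrite lee_fin mulr_ge0 ?powR_ge0 ?expR_ge0.
rewrite (gtr0_norm st0).
under eq_integral => y _.
  have -> : beta_kernel p (t, Num.sqrt t * y + 0) = t `^ p * expR (- t) * bump p y.
    rewrite /beta_kernel/= addr0 exprMn sqr_sqrtr ?(ltW t0)//.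
    have -> : t - t * y ^+ 2 = t * (1 - y ^+ 2) by ring.
    rewrite -[X in Num.max _ X](mulr0 t) -maxr_pMr ?(ltW t0)// powRM ?(ltW t0)//.
      by rewrite /bump; ring.
    by rewrite le_max lexx orbT.
  rewrite EFinM.
  over.
rewrite ge0_integralZl//; last 3 first.
- by apply/measurable_EFinP; exact: measurable_bump.
- by move=> y _; rewrite lee_fin bump_ge0.
- by rewrite lee_fin mulr_ge0 ?powR_ge0 ?expR_ge0.
rewrite muleA -EFinM; congr (_%:E * _)%E.
rewrite /gamma_fun max_l ?(ltW t0)// powRD ?(gt_eqF t0) ?implybT//.
by rewrite div1r powR12_sqrt ?(ltW t0)//; ring.
Qed.

Lemma integral_beta_kernel2 p z : 0 < p ->
  (\int[mu]_t (beta_kernel p (t, z))%:E =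
   (gauss_fun z)%:E * \int[mu]_t (gamma_fun p t)%:E)%E.
Proof.
move=> p0.
rewrite (@ge0_integral_affine _ 1 (z ^+ 2))//; last 2 first.
- apply/measurable_EFinP.
  exact: (measurableT_comp (measurable_beta_kernel (ltW p0)) (measurable_pair2 z)).
- by move=> t; rewrite lee_fin mulr_ge0 ?powR_ge0 ?expR_ge0.
rewrite normr1 mul1e.
under eq_integral => t _.
  have -> : beta_kernel p (1 * t + z ^+ 2, z) = gauss_fun z * gamma_fun p t.
    by rewrite /beta_kernel/= mul1r addrK opprD expRD /gauss_fun /gamma_fun; ring.
  rewrite EFinM.
  over.
rewrite ge0_integralZl//.
- by apply/measurable_EFinP; exact: measurable_gamma_fun.
- by move=> t _; rewrite lee_fin gamma_fun_ge0.
- by rewrite lee_fin gauss_fun_ge0.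
Qed.

Lemma beta_gamma p : 0 < p ->
  (\int[mu]_t (gamma_fun (p + 1 / 2) t)%:E * \int[mu]_y (bump p y)%:E =
   (Num.sqrt pi)%:E * \int[mu]_t (gamma_fun p t)%:E)%E.
Proof.
move=> p0; have p1 : 0 < p + 1 / 2 by lra.
have mk := measurable_beta_kernel (ltW p0).
have := @fubini_tonelli _ _ _ _ R mu mu (EFin \o beta_kernel p).
have mk' : measurable_fun setT (EFin \o beta_kernel p) by exact/measurable_EFinP.
have k0 w : (0 <= (EFin \o beta_kernel p) w)%E.
  by rewrite lee_fin mulr_ge0 ?powR_ge0 ?expR_ge0.
move=> /(_ mk' k0).
rewrite /=.
under eq_integral do rewrite integral_beta_kernel1//.
under [in RHS]eq_integral do rewrite integral_beta_kernel2//.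
rewrite ge0_integralZr//; last 3 first.
- by apply/measurable_EFinP; exact: measurable_gamma_fun p1.
- by move=> t _; rewrite lee_fin gamma_fun_ge0.
- by apply: integral_ge0 => y _; rewrite lee_fin bump_ge0.
move=> ->; rewrite ge0_integralZr//; last 3 first.
- by apply/measurable_EFinP; exact: measurable_gauss_fun.
- by move=> t _; rewrite lee_fin gauss_fun_ge0.
- by apply: integral_ge0 => y _; rewrite lee_fin gamma_fun_ge0.
by rewrite integralT_gauss.
Qed.

(** From [ln x <= x - 1] at [x = t / (2 p)] follows [t^p <= (2 p)^p e^(t/2)], so the function is
    dominated by a multiple of the exponential density of rate [1/2]; the 2 in [C] undoes the
    normalisation of that density. *)
Lemma integrable_gamma_fun p : 0 < p -> mu.-integrable setT (EFin \o gamma_fun p).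
Proof.
move=> p0.
pose C := 2 * (2 * p) `^ p.
have h2 : 0 < 2^-1 :> R by lra.
apply: (@le_integrable _ _ _ mu setT _ _ (fun t => C%:E * (exponential_pdf 2^-1 t)%:E)%E) => //.
- by apply/measurable_EFinP; exact: measurable_gamma_fun.
- move=> t _; rewrite -EFinM !abse_EFin lee_fin.
  rewrite ger0_norm ?gamma_fun_ge0// (le_trans _ (ler_norm _))//.
  rewrite /gamma_fun; have [t0|t0] := leP t 0.
    by rewrite powR0 ?gt_eqF// mul0r mulr_ge0 ?mulr_ge0 ?powR_ge0 ?exponential_pdf_ge0// ltW.
  rewrite exponential_pdfE ?(ltW t0)// /C.
  have -> : 2 * (2 * p) `^ p * (2^-1 * expR (- 2^-1 * t)) = (2 * p) `^ p * expR (- 2^-1 * t).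
    by field.
  have e : t `^ p <= (2 * p) `^ p * expR (2^-1 * t).
    have p2 : 0 < 2 * p by lra.
    rewrite /powR !gt_eqF// -expRD ler_expR.
    have u0 : 0 < t / (2 * p) by rewrite divr_gt0.
    have := @le_ln1Dx R (t / (2 * p) - 1).
    rewrite (addrC 1) subrK => /(_ _)/wrap[]; first by lra.
    rewrite ln_div ?posrE// => h.
    have : p * (ln t - ln (2 * p)) <= p * (t / (2 * p)) by rewrite ler_pM2l//; lra.
    have -> : p * (t / (2 * p)) = 2^-1 * t by field; rewrite gt_eqF.
    by lra.
  apply: (le_trans (ler_wpM2r (expR_ge0 _) e)).
  rewrite -mulrA -expRD ler_wpM2l ?powR_ge0// ler_expR; lra.
- by apply: integrableZl => //; exact: integrable_exponential_pdf.
Qed.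

Lemma integral_gamma_fun_gt0 p : 0 < p -> 0 < \int[mu]_t gamma_fun p t.
Proof.
move=> p0.
have cg := continuous_gamma_fun (ltW p0).
apply: (@lt_le_trans _ _ (\int[mu]_(t in `[1, 2]) expR (-2))).
  rewrite Rintegral_cst//= lebesgue_measure_itv/= lte_fin ltr1n/=.
  by rewrite mulr_gt0 ?expR_gt0//; lra.
apply: (@le_trans _ _ (\int[mu]_(t in `[1, 2]) gamma_fun p t)).
  apply: le_Rintegral => //.
  - by apply: continuous_itv_integrable; exact: continuous_cst_fun.
  - exact: continuous_itv_integrable.
  - move=> t; rewrite /= in_itv/= => /andP[t1 t2].
    rewrite /gamma_fun max_l; last by lra.
    have q : 1 <= t `^ p by rewrite -[leLHS](powRr0 t) ler_powR// ltW.
    have : expR (-2) <= expR (- t) by rewrite ler_expR; lra.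
    by have := expR_ge0 (-2 : R); nra.
rewrite Rintegral_mkcond; apply: le_Rintegral => //.
- rewrite -restrict_EFin; apply/integrable_restrict => //.
  by rewrite setTI; exact: continuous_itv_integrable.
- exact: integrable_gamma_fun.
- by move=> t _; rewrite /patch; case: ifP => // _; exact: gamma_fun_ge0.
Qed.

Lemma GammaE p : 0 < p -> Gamma (1 + p) = \int[mu]_t gamma_fun p t.
Proof.
move=> p0; rewrite /Gamma [LHS]Rintegral_mkcond; apply: eq_Rintegral => t _.
rewrite /patch mem_setE in_itv/= andbT /gamma_fun.
have [t0|t0] := leP t 0; first by rewrite powR0 ?gt_eqF// mul0r.
by rewrite addrC addKr.
Qed.

Lemma integrable_bump p : 0 < p -> mu.-integrable setT (EFin \o bump p).
Proof.
move=> p0.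
have -> : bump p = (bump p) \_ `[-1, 1].
  apply/funext => y; rewrite /patch mem_setE in_itv/=; case: ifPn => // y1.
  rewrite bump_out ?gt_eqF//; move: y1; rewrite -ler_norml -ltNge; exact: ltW.
rewrite -restrict_EFin; apply/integrable_restrict => //.
by rewrite setTI; apply: continuous_itv_integrable; exact/continuous_bump/ltW.
Qed.

Lemma Gamma_bump p : 0 < p ->
  Gamma (3 / 2 + p) * \int[mu]_y bump p y = Num.sqrt pi * Gamma (1 + p).
Proof.
move=> p0; have p1 : 0 < p + 1 / 2 by lra.
have -> : 3 / 2 + p = 1 + (p + 1 / 2) by field.
rewrite !GammaE// /Rintegral.
have i1 := integrable_fin_num measurableT (integrable_gamma_fun p1).
have i2 := integrable_fin_num measurableT (integrable_gamma_fun p0).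
have i3 := integrable_fin_num measurableT (integrable_bump p0).
by have := congr1 fine (beta_gamma p0); rewrite !fineM.
Qed.

End BetaGamma.

(** * The transform of the self-convolution *)

Section RealFubini.
Variable R : realType.
Notation mu := (@lebesgue_measure R).

(** Integrability of every section makes each inner extended integral finite, so that the [fine]
    inside the outer integral can be undone. *)
Lemma Rintegral_Fubini (q : R * R -> R) :
  (mu \x mu)%E.-integrable setT (EFin \o q) ->
  (forall x, mu.-integrable setT (fun y => (q (x, y))%:E)) ->
  (forall y, mu.-integrable setT (fun x => (q (x, y))%:E)) ->
  \int[mu]_x (\int[mu]_y q (x, y)) = \int[mu]_y (\int[mu]_x q (x, y)).
Proof.
move=> iq i1 i2; have := Fubini iq => /(congr1 fine) /= e.
rewrite /Rintegral; under eq_integral => x _.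
  rewrite fineK; last exact: integrable_fin_num (i1 x).
  over.
under [in RHS]eq_integral => y _.
  rewrite fineK; last exact: integrable_fin_num (i2 y).
  over.
exact: e.
Qed.

Lemma integrable_EFinB (f g : R -> R) : mu.-integrable setT (EFin \o f) ->
  mu.-integrable setT (EFin \o g) -> mu.-integrable setT (EFin \o (fun x => f x - g x)).
Proof. by move=> i1 i2; have := integrableB measurableT i1 i2. Qed.

Lemma integrable_EFinZl c (f : R -> R) : mu.-integrable setT (EFin \o f) ->
  mu.-integrable setT (EFin \o (fun x => c * f x)).
Proof. by move=> i1; have := integrableZl measurableT c i1. Qed.

Lemma integrable_Rintegral1 (q : R * R -> R) :
  (mu \x mu)%E.-integrable setT (EFin \o q) ->
  (forall x, mu.-integrable setT (fun y => (q (x, y))%:E)) ->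
  mu.-integrable setT (EFin \o (fun x => \int[mu]_y q (x, y))).
Proof.
move=> iq i1; have := integrable_fubini_F iq; rewrite /fubini_F /=.
congr (mu.-integrable setT _); apply/funext => x /=.
by rewrite fineK//; exact: integrable_fin_num (i1 x).
Qed.

End RealFubini.

Section Transform.
Variable R : realType.
Notation mu := (@lebesgue_measure R).
Implicit Types (nu X t s x y : R).

Lemma f_nuE nu x : 0 < nu -> f_nu nu x = bump nu x.
Proof.
move=> nu0; rewrite /f_nu; case: ifPn => [|]; first by rewrite ltr_norml => ?; rewrite bumpE.
by rewrite -leNgt => x1; rewrite bump_out// gt_eqF.
Qed.

Lemma integrable_bumpM nu (v : R -> R) : 0 < nu -> measurable_fun setT v ->
  (forall y, `|v y| <= 1) -> mu.-integrable setT (fun y => (bump nu y * v y)%:E).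
Proof.
move=> nu0 mv v1; apply: (@le_integrable _ _ _ mu setT _ _ (EFin \o bump nu)) => //.
- apply/measurable_EFinP; apply: measurable_funM => //; exact: measurable_bump.
- move=> y _ /=; rewrite lee_fin normrM ler_piMr//.
- exact: integrable_bump.
Qed.

Definition self_conv nu u := \int[mu]_y (bump nu y * bump nu (u - y)).

Lemma measurable_cosM s : measurable_fun setT (fun y : R => cos (s * y)).
Proof. by apply: continuous_measurable_fun; exact: continuous_cosM. Qed.

Lemma measurable_sinM s : measurable_fun setT (fun y : R => sin (s * y)).
Proof. by apply: continuous_measurable_fun; exact: continuous_sinM. Qed.

Lemma measurable_bump_sub nu u : 0 < nu -> measurable_fun setT (fun y => bump nu (u - y)).
Proof.
move=> nu0; apply: (@measurableT_comp _ _ _ _ _ _ (@bump R nu)); first exact: measurable_bump.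
by apply: measurable_funB.
Qed.

Lemma bump_norm_le1 nu y : 0 < nu -> `|bump nu y| <= 1.
Proof. by move=> nu0; rewrite ger0_norm ?bump_ge0 ?bump_le1// ltW. Qed.

Lemma self_conv_even nu u : 0 < nu -> self_conv nu (- u) = self_conv nu u.
Proof.
move=> nu0; rewrite /self_conv (@Rintegral_affine _ (-1) 0) ?oppr_eq0 ?oner_eq0//.
  rewrite normrN1 mul1r; apply: eq_Rintegral => y _.
  by rewrite mulN1r addr0 bumpN -(bumpN nu (u - y)); congr (_ * bump _ _); ring.
apply: integrable_bumpM => //; first exact: measurable_bump_sub.
by move=> y; exact: bump_norm_le1.
Qed.

Lemma self_conv_out nu u : 0 < nu -> 2 < u -> self_conv nu u = 0.
Proof.
move=> nu0 u2; rewrite /self_conv.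
transitivity (\int[mu]_y (0 : R)); last by rewrite Rintegral_cst// mul0r.
apply: eq_Rintegral => y _; have [y1|y1] := leP 1 `|y|.
  by rewrite bump_out ?mul0r// gt_eqF.
rewrite (@bump_out _ _ (u - y)) ?mulr0 ?gt_eqF//.
move: y1; rewrite ltr_norml => /andP[_ y1].
by rewrite (le_trans _ (ler_norm _))//; lra.
Qed.

Lemma Rintegral_bump_cos nu s : 0 < nu -> \int[mu]_y (bump nu y * cos (s * y)) = 2 * cosT nu s.
Proof.
move=> nu0; rewrite Rintegral_even; last 2 first.
- apply: integrable_bumpM => //; first exact: measurable_cosM.
  by move=> y; exact: cos_max.
- by move=> y; rewrite bumpN mulrN cosN.
congr (2 * _); rewrite /cosT Rintegral_mkcond [RHS]Rintegral_mkcond.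
apply: eq_Rintegral => y _; rewrite /patch !mem_setE !in_itv/= andbT.
have [y0|//] := leP 0 y; have [//|y1] := leP y 1.
by rewrite bump_out ?mul0r ?gt_eqF// ger0_norm ?(ltW y1).
Qed.

Lemma Rintegral_bump_sin nu s : 0 < nu -> \int[mu]_y (bump nu y * sin (s * y)) = 0.
Proof.
move=> nu0; set I := LHS.
have i1 : mu.-integrable setT (EFin \o (fun y => bump nu y * sin (s * y))).
  apply: integrable_bumpM => //; first exact: measurable_sinM.
  by move=> y; exact: sin_max.
suff : I = - I by lra.
rewrite {1}/I (@Rintegral_affine _ (-1) 0) ?oppr_eq0 ?oner_eq0// normrN1 mul1r.
rewrite -[RHS]mulN1r /I -RintegralZl//; apply: eq_Rintegral => y _.
by rewrite mulN1r addr0 bumpN mulrN sinN; ring.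
Qed.

(** Substitute [u = 2 x / X - y], so that [t x = s y + s u], and expand the cosine: the sine part
    vanishes by oddness. The factor [X] is the Jacobian [X / 2] times the 2 lost in the half-range
    [cosT]. *)
Lemma Rintegral_bump_shift nu X t y : 0 < nu -> 0 < X ->
  \int[mu]_x (bump nu y * bump nu (2 * x / X - y) * cos (t * x)) =
  X * (cosT nu (t * X / 2) * (bump nu y * cos (t * X / 2 * y))).
Proof.
move=> nu0 X0; set s := t * X / 2.
have Xn : X != 0 by rewrite gt_eqF.
have ic : mu.-integrable setT (EFin \o (fun u => bump nu u * cos (s * u))).
  apply: integrable_bumpM => //; first exact: measurable_cosM.
  by move=> u; exact: cos_max.
have is_ : mu.-integrable setT (EFin \o (fun u => bump nu u * sin (s * u))).
  apply: integrable_bumpM => //; first exact: measurable_sinM.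
  by move=> u; exact: sin_max.
have iD : mu.-integrable setT (EFin \o (fun u =>
    bump nu y * cos (s * y) * (bump nu u * cos (s * u)) -
    bump nu y * sin (s * y) * (bump nu u * sin (s * u)))).
  exact: integrable_EFinB (integrable_EFinZl _ ic) (integrable_EFinZl _ is_).
have a0 : 2 / X != 0 by rewrite mulf_neq0 ?invr_neq0 ?pnatr_eq0.
have H := @Rintegral_affine R (2 / X) (- y) _ a0 iD.
rewrite (ger0_norm (_ : 0 <= 2 / X)) ?divr_ge0 ?(ltW X0)// in H.
transitivity (X / 2 * (2 / X * \int[mu]_x (bump nu y * bump nu (2 * x / X - y) * cos (t * x)))).
  by field.
have -> : 2 / X * \int[mu]_x (bump nu y * bump nu (2 * x / X - y) * cos (t * x)) =
  \int[mu]_u (bump nu y * cos (s * y) * (bump nu u * cos (s * u)) -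
    bump nu y * sin (s * y) * (bump nu u * sin (s * u))).
  rewrite H; congr (_ * _); apply: eq_Rintegral => x _.
  have -> : 2 / X * x - y = 2 * x / X - y by ring.
  have -> : t * x = s * y + s * (2 * x / X - y) by rewrite /s; field.
  by rewrite cosD; ring.
rewrite RintegralB//; last 2 first.
- exact: integrable_EFinZl ic.
- exact: integrable_EFinZl is_.
rewrite !RintegralZl// Rintegral_bump_cos// Rintegral_bump_sin//.
by field.
Qed.

(** Tonelli with [x] innermost: the cosine is bounded by 1, and the shifted bump integrates to
    [X / 2] times its total mass whatever [y] is, leaving a multiple of [bump nu y]. *)
Lemma integrable_self_conv_kernel nu X t : 0 < nu -> 0 < X ->
  (mu \x mu)%E.-integrable setT (EFin \o
    (fun w : R * R => bump nu w.2 * bump nu (2 * w.1 / X - w.2) * cos (t * w.1))).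
Proof.
move=> nu0 X0; set q := fun w : R * R => _.
have Xn : X != 0 by rewrite gt_eqF.
have mq : measurable_fun [set: measurableTypeR R * measurableTypeR R] q.
  apply: measurable_funM.
    apply: measurable_funM.
      apply: (@measurableT_comp _ _ _ _ _ _ (@bump R nu)) => //; exact: measurable_bump.
    apply: (@measurableT_comp _ _ _ _ _ _ (@bump R nu)); first exact: measurable_bump.
    apply: measurable_funB => //; apply: measurable_funM => //.
    exact: measurable_funM.
  by apply: (@measurableT_comp _ _ _ _ _ _ (fun x : R => cos (t * x))) => //; exact: measurable_cosM.
apply/integrable21ltyP; first exact/measurable_EFinP.
have iI := integrable_fin_num measurableT (integrable_bump nu0).
pose I := \int[mu]_y bump nu y.
have pw0 : (0 <= \int[mu]_y (bump nu y)%:E)%E.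
  by apply: integral_ge0 => y _; rewrite lee_fin bump_ge0.
apply: (@le_lt_trans _ _ (\int[mu]_y ((bump nu y)%:E * (X / 2 * I)%:E))%E).
  apply: ge0_le_integral => //.
  - by move=> y _; apply: integral_ge0.
  - have mq' : measurable_fun [set: measurableTypeR R * measurableTypeR R]
        (abse \o (EFin \o q)).
      by apply: measurableT_comp => //; exact/measurable_EFinP.
    have q0 w : (0 <= (abse \o (EFin \o q)) w)%E by exact: abse_ge0.
    exact: (@measurable_fun_fubini_tonelli_G _ _ _ _ R mu _ mq' q0).
  - by apply: emeasurable_funM => //; apply/measurable_EFinP; exact: measurable_bump.
  - move=> y _.
    apply: (@le_trans _ _ (\int[mu]_x (bump nu y * bump nu (2 * x / X - y))%:E)%E).
      apply: ge0_le_integral => //.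
      + by apply: measurableT_comp => //; apply/measurable_EFinP; exact: (measurableT_comp mq (measurable_pair2 y)).
      + apply/measurable_EFinP; apply: measurable_funM => //.
        apply: (@measurableT_comp _ _ _ _ _ _ (@bump R nu)); first exact: measurable_bump.
        by apply: measurable_funB => //; apply: measurable_funM => //; exact: measurable_funM.
      + move=> x _; rewrite lee_fin /q/= normrM ger0_norm ?mulr_ge0 ?bump_ge0//.
        by rewrite ler_piMr ?mulr_ge0 ?bump_ge0 ?cos_max.
    under eq_integral do rewrite EFinM.
    rewrite ge0_integralZl//; last 3 first.
    + apply/measurable_EFinP.
      apply: (@measurableT_comp _ _ _ _ _ _ (@bump R nu)); first exact: measurable_bump.
      by apply: measurable_funB => //; apply: measurable_funM => //; exact: measurable_funM.
    + by move=> x _; rewrite lee_fin bump_ge0.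
    + by rewrite lee_fin bump_ge0.
    apply: lee_wpmul2l; first by rewrite lee_fin bump_ge0.
    rewrite (@ge0_integral_affine _ (X / 2) (X / 2 * y)); last 3 first.
    + by rewrite mulf_neq0// invr_neq0.
    + apply/measurable_EFinP.
      apply: (@measurableT_comp _ _ _ _ _ _ (@bump R nu)); first exact: measurable_bump.
      by apply: measurable_funB => //; apply: measurable_funM => //; exact: measurable_funM.
    + by move=> x; rewrite lee_fin bump_ge0.
    rewrite ger0_norm ?divr_ge0 ?(ltW X0)// (EFinM (X / 2) I); apply: lee_wpmul2l.
      by rewrite lee_fin divr_ge0 ?(ltW X0).
    rewrite /I /Rintegral (fineK iI) le_eqVlt; apply/orP; left; apply/eqP.
    apply: eq_integral => u _; congr (bump _ _)%:E.
    by field.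
rewrite ge0_integralZr//; last 3 first.
- by apply/measurable_EFinP; exact: measurable_bump.
- by move=> y _; rewrite lee_fin bump_ge0.
- by rewrite lee_fin mulr_ge0 ?divr_ge0 ?(ltW X0)// fine_ge0.
by rewrite -(fineK iI) -EFinM ltry.
Qed.

Definition gnorm nu : R := Gamma (3 / 2 + 2 * nu) / (Num.sqrt pi * Gamma (1 + 2 * nu)).

Lemma g_nuXE nu X x : 0 < nu -> g_nuX nu X x = gnorm nu * self_conv nu (2 * x / X).
Proof.
move=> nu0; rewrite /g_nuX; congr (_ * _).
by apply: eq_Rintegral => y _; rewrite !f_nuE.
Qed.

(** The convolution theorem for the cosine transform. The kernel [k] is even, so the 2 in the
    definition of [h_nuX] extends the integral to the whole line; after Fubini the two integrations
    yield one factor [cosT] each. *)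
Lemma h_nuXE nu X t : 0 < nu -> 0 < X ->
  h_nuX nu X t = 2 * gnorm nu * X * cosT nu (t * X / 2) ^+ 2.
Proof.
move=> nu0 X0; pose q (w : R * R) := bump nu w.2 * bump nu (2 * w.1 / X - w.2) * cos (t * w.1).
have iq : (mu \x mu)%E.-integrable setT (EFin \o q) := integrable_self_conv_kernel t nu0 X0.
have Xn : X != 0 by rewrite gt_eqF.
have i1 x : mu.-integrable setT (fun y => (q (x, y))%:E).
  have -> : (fun y => (q (x, y))%:E) =
      fun y => (bump nu y * (bump nu (2 * x / X - y) * cos (t * x)))%:E.
    by apply/funext => y; rewrite /q/= mulrA.
  apply: integrable_bumpM => //.
    by apply: measurable_funM => //; exact: measurable_bump_sub.
  by move=> y; rewrite normrM mulr_ile1 ?bump_norm_le1 ?cos_max.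
have i2 y : mu.-integrable setT (fun x => (q (x, y))%:E).
  have -> : (fun x => (q (x, y))%:E) = EFin \o (fun x =>
      (fun u => bump nu u * (bump nu y * cos (t * (X / 2 * (u + y))))) (2 / X * x + - y)).
    apply/funext => x; rewrite /q/=; congr EFin.
    have -> : 2 * x / X - y = 2 / X * x - y by ring.
    have -> : X / 2 * (2 / X * x - y + y) = x by field.
    by ring.
  apply: (@integrable_affine R (2 / X) (- y) (fun u => bump nu u *
    (bump nu y * cos (t * (X / 2 * (u + y))))));
    first by rewrite mulf_neq0 ?invr_neq0 ?pnatr_eq0.
  apply: integrable_bumpM => //.
    apply: measurable_funM => //.
    apply: (@measurableT_comp _ _ _ _ _ _ (fun x : R => cos (t * x))); first exact: measurable_cosM.
    by apply: measurable_funM => //; exact: measurable_funD.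
  by move=> u; rewrite normrM mulr_ile1 ?bump_norm_le1 ?cos_max.
pose k x := self_conv nu (2 * x / X) * cos (t * x).
have kE : k = fun x => \int[mu]_y q (x, y).
  apply/funext => x; rewrite /k /self_conv -RintegralZr//.
  apply: integrable_bumpM => //; first exact: measurable_bump_sub.
  by move=> y; exact: bump_norm_le1.
have ik : mu.-integrable setT (EFin \o k) by rewrite kE; exact: integrable_Rintegral1.
have ke x : k (- x) = k x.
  by rewrite /k (mulrN t) cosN (mulrN 2) mulNr self_conv_even.
have ik0 : mu.-integrable `[0, +oo[ (EFin \o k) by exact: integrableS ik.
have -> : h_nuX nu X t = gnorm nu * (2 * \int[mu]_(x in `[0, +oo[) k x).
  rewrite [RHS]mulrCA -RintegralZl// /h_nuX; congr (2 * _).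
  by apply: eq_Rintegral => x _; rewrite g_nuXE// /k mulrA.
rewrite -Rintegral_even// kE Rintegral_Fubini//.
have -> : \int[mu]_y (\int[mu]_x q (x, y)) =
    \int[mu]_y (X * cosT nu (t * X / 2) * (bump nu y * cos (t * X / 2 * y))).
  by apply: eq_Rintegral => y _; rewrite -[RHS]mulrA; exact: Rintegral_bump_shift.
rewrite RintegralZl//; last first.
  apply: integrable_bumpM => //; first exact: measurable_cosM.
  by move=> u; exact: cos_max.
by rewrite Rintegral_bump_cos//; ring.
Qed.

End Transform.

(** * Proof of the lemma *)

Section Final.
Variable R : realType.
Notation mu := (@lebesgue_measure R).
Implicit Types (nu p s eps : R).

Lemma gnorm_bump nu : 0 < nu -> gnorm nu * \int[mu]_y bump (2 * nu) y = 1.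
Proof.
move=> nu0; have p0 : 0 < 2 * nu by lra.
have G0 : 0 < Num.sqrt pi * Gamma (1 + 2 * nu) :> R.
  by rewrite mulr_gt0 ?sqrtr_gt0 ?pi_gt0// GammaE// integral_gamma_fun_gt0.
rewrite /gnorm mulrAC Gamma_bump// mulfV//; exact: lt0r_neq0.
Qed.

Lemma powR_onem_ge p : 0 < p -> expR (-1) <= (1 - (2 * p + 2)^-1) `^ p.
Proof.
move=> p0; have q0 : 0 < 2 * p + 2 by lra.
set x := (2 * p + 2)^-1.
have x0 : 0 < x by rewrite invr_gt0.
have x1 : x <= 1 / 2 by rewrite /x div1r lef_pV2 ?posrE//; lra.
have y0 : 0 < 1 - x by lra.
rewrite /powR gt_eqF// ler_expR -[X in ln X]invrK lnV ?posrE ?invr_gt0//.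
have -> : (1 - x)^-1 = 1 + (2 * p + 1)^-1.
  by rewrite /x; field; rewrite !gt_eqF//; lra.
have z0 : 0 < (2 * p + 1)^-1 by rewrite invr_gt0; lra.
have h : ln (1 + (2 * p + 1)^-1) <= (2 * p + 1)^-1 by apply: le_ln1Dx; lra.
rewrite mulrN lerN2; apply: (le_trans (ler_wpM2l (ltW p0) h)).
by rewrite ler_pdivrMr; lra.
Qed.

(** The mass concentrates on width of order [p^(-1/2)]. For [y^2 <= 1 / (2 p + 2)] the bump stays
    above [1/e], and the shift by 2 keeps this choice valid for small [p]. *)
Lemma Rintegral_bump_ge p : 0 < p ->
  (Num.sqrt (2 * p + 2))^-1 * expR (-1) <= \int[mu]_y bump p y.
Proof.
move=> p0; have q0 : 0 < 2 * p + 2 by lra.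
have cp := @continuous_bump R p (ltW p0).
set d := (Num.sqrt (2 * p + 2))^-1.
have d0 : 0 < d by rewrite invr_gt0 sqrtr_gt0.
have d2 : d ^+ 2 = (2 * p + 2)^-1 by rewrite /d exprVn sqr_sqrtr ?(ltW q0).
have x1 : d ^+ 2 <= 1 / 2 by rewrite d2 div1r lef_pV2 ?posrE//; lra.
apply: (@le_trans _ _ (\int[mu]_(y in `[0, d]) expR (-1))).
  rewrite Rintegral_cst//= lebesgue_measure_itv/= lte_fin d0/=.
  by rewrite subr0 mulrC.
apply: (@le_trans _ _ (\int[mu]_(y in `[0, d]) bump p y)).
  apply: le_Rintegral => //.
  - by apply: continuous_itv_integrable; exact: continuous_cst_fun.
  - exact: continuous_itv_integrable.
  - move=> y; rewrite /= in_itv/= => /andP[y0 yd].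
    apply: (le_trans (powR_onem_ge p0)); rewrite -d2.
    have y2 : y ^+ 2 <= d ^+ 2 by rewrite lerXn2r ?nnegrE ?(ltW d0).
    apply: ge0_ler_powR; rewrite ?nnegrE ?(ltW p0) ?le_max ?lexx ?orbT//; first by lra.
    by rewrite lerD2l lerN2 y2.
rewrite Rintegral_mkcond; apply: le_Rintegral => //.
- rewrite -restrict_EFin; apply/integrable_restrict => //.
  by rewrite setTI; exact: continuous_itv_integrable.
- exact: integrable_bump.
- by move=> y _; rewrite /patch; case: ifP => // _; exact: bump_ge0.
Qed.

Lemma gnorm_gt0 nu : 0 < nu -> 0 < gnorm nu.
Proof.
move=> nu0; have p0 : 0 < 2 * nu by lra.
have := gnorm_bump nu0; have : 0 <= \int[mu]_y bump (2 * nu) y.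
  by apply: Rintegral_ge0 => y _; exact: bump_ge0.
by nra.
Qed.

Lemma gnorm_le nu : 0 < nu -> gnorm nu <= Num.sqrt (4 * nu + 2) * expR 1.
Proof.
move=> nu0; have p0 : 0 < 2 * nu by lra.
have := Rintegral_bump_ge p0; have := gnorm_bump nu0; have c0 := gnorm_gt0 nu0.
have -> : 2 * (2 * nu) + 2 = 4 * nu + 2 by ring.
set I := Rintegral _ _ _ => e.
have s0 : 0 < Num.sqrt (4 * nu + 2) by rewrite sqrtr_gt0; lra.
rewrite expRN -invfM => h.
have k0 : 0 < Num.sqrt (4 * nu + 2) * expR 1 by rewrite mulr_gt0 ?expR_gt0.
have := ler_wpM2l (ltW c0) h; rewrite e ler_pdivrMr// mul1r.
exact.
Qed.

Lemma stirling_sqr nu : 0 <= nu ->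
  stirling nu ^+ 2 = 2 `^ (2 * nu) * expR (- (2 * nu)) * (nu + 1) `^ (2 * nu + 1).
Proof.
move=> nu0; have n1 : nu + 1 != 0 by rewrite gt_eqF//; lra.
have -> : 2 * nu + 1 = (nu + 1 / 2) + (nu + 1 / 2) by field.
have -> : 2 * nu = nu + nu by ring.
rewrite opprD expRD (@powRD _ 2) ?pnatr_eq0 ?implybT//.
rewrite (@powRD _ (nu + 1) (nu + 1 / 2) (nu + 1 / 2)) ?n1 ?implybT//.
by rewrite /stirling; ring.
Qed.

(** The bound [nu >= eps] is spent here on comparing shifted quantities with powers of [nu]:
    [4 nu + 2 <= (4 + 2/eps) nu] and [(1 + 1/nu)^(2 nu + 1) <= e^(2 + 1/nu)]. Writing [sqrt nu] as
    [nu * nu^(-1/2)] supplies the missing power in [nu^(2 nu + 2)]. *)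
Lemma sqrt_stirling_le eps nu : 0 < eps -> eps <= nu ->
  Num.sqrt (4 * nu + 2) * stirling nu ^+ 2 <=
  Num.sqrt (4 + 2 / eps) * expR (2 + eps^-1) *
  (nu `^ (- (1 / 2)) * expR (- (2 * nu)) * (2 * nu) `^ (2 * nu + 2)).
Proof.
move=> e0 enu; have nu0 : 0 < nu by lra.
have nn : nu != 0 by rewrite gt_eqF.
have iv : nu^-1 <= eps^-1 by rewrite lef_pV2 ?posrE.
have h1 : Num.sqrt (4 * nu + 2) <= Num.sqrt (4 + 2 / eps) * (nu * nu `^ (- (1 / 2))).
  have -> : nu * nu `^ (- (1 / 2)) = Num.sqrt nu.
    rewrite -powR12_sqrt ?(ltW nu0)// -[X in X * _](@powRr1 _ nu) ?(ltW nu0)//.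
    by rewrite -powRD ?nn ?implybT//; congr powR; field.
  rewrite -sqrtrM; last by rewrite addr_ge0// divr_ge0// ltW.
  rewrite ler_wsqrtr//.
  have -> : 4 * nu + 2 = (4 + 2 * nu^-1) * nu by field.
  by rewrite ler_wpM2r ?(ltW nu0)//; lra.
have h2 : (nu + 1) `^ (2 * nu + 1) <= expR (2 + eps^-1) * nu `^ (2 * nu + 1).
  have -> : nu + 1 = nu * (1 + nu^-1) by rewrite mulrDr mulr1 mulfV.
  have v0 : 0 < nu^-1 by rewrite invr_gt0.
  rewrite powRM ?(ltW nu0)//; last by lra.
  rewrite mulrC ler_wpM2r ?powR_ge0// /powR gt_eqF; last by lra.
  rewrite ler_expR.
  have l : ln (1 + nu^-1) <= nu^-1 by apply: le_ln1Dx; lra.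
  have w0 : 0 <= 2 * nu + 1 by lra.
  apply: (le_trans (ler_wpM2l w0 l)).
  have -> : (2 * nu + 1) / nu = 2 + nu^-1 by field.
  by rewrite lerD2l.
rewrite stirling_sqr ?(ltW nu0)//.
set E := expR (- (2 * nu)); set P := 2 `^ (2 * nu); set Z := nu `^ (2 * nu + 1) in h2 *.
set V := nu `^ (- (1 / 2)) in h1 *; set S := Num.sqrt (4 + 2 / eps) in h1 *.
set Q := expR (2 + eps^-1) in h2 *.
have E0 : 0 <= E by exact: expR_ge0.
have P0 : 0 <= P by exact: powR_ge0.
have Z0 : 0 <= Z by exact: powR_ge0.
have V0 : 0 <= V by exact: powR_ge0.
have S0 : 0 <= S by exact: sqrtr_ge0.
have Q0 : 0 <= Q by exact: expR_ge0.
have -> : (2 * nu) `^ (2 * nu + 2) = 4 * P * (Z * nu).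
  rewrite powRM ?(ltW nu0)//; have -> : 2 * nu + 2 = 2 * nu + 1 + 1 by ring.
  rewrite !powRD ?nn ?pnatr_eq0 ?implybT// !powRr1 ?(ltW nu0)//.
  by rewrite /Z powRD ?nn ?implybT// powRr1 ?(ltW nu0)// /P; ring.
apply: (@le_trans _ _ (S * (nu * V) * (P * E * (Q * Z)))).
  apply: ler_pM; [exact: sqrtr_ge0| |exact: h1|].
    by rewrite !mulr_ge0 ?powR_ge0.
  by apply: ler_wpM2l h2; rewrite mulr_ge0.
(* Since [2^(2 nu + 2) = 4 * 2^(2 nu)], the right side is four times the left and the difference
   three times it. *)
rewrite -subr_ge0.
have -> : S * Q * (V * E * (4 * P * (Z * nu))) - S * (nu * V) * (P * E * (Q * Z)) =
   3 * (S * Q * (V * E * (P * (Z * nu)))) by ring.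
by rewrite mulr_ge0// !mulr_ge0// ltW.
Qed.

Lemma h_nuX_bound eps : 0 < eps -> exists2 C : R, 0 < C &
  forall nu X t : R, 0 < X -> eps <= nu -> nu <= `|X * t / 4| ->
    `|h_nuX nu X t| <= C * (nu `^ (- (1 / 2)) * expR (- (2 * nu)) * X
              * `|4 * nu / (X * t)| `^ (2 * nu + 2)).
Proof.
move=> e0; have [C0 C00 HW] := scosT_bound R.
pose Q := Num.sqrt (4 + 2 / eps) * expR (2 + eps^-1).
have Q0 : 0 < Q.
  by rewrite mulr_gt0 ?expR_gt0// sqrtr_gt0 addr_gt0// divr_gt0.
(* The factors come from [h_nuXE], [gnorm_le], the square of [scosT_bound] and [sqrt_stirling_le],
   in this order. *)
exists (2 * expR 1 * C0 ^+ 2 * Q).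
  apply: mulr_gt0; last exact: Q0.
  by apply: mulr_gt0; [rewrite mulr_gt0 ?expR_gt0|exact: exprn_gt0].
move=> nu X t X0 enu nut; have nu0 : 0 < nu by lra.
rewrite h_nuXE// -cosT_norm.
set s := `|t * X / 2|.
have sE : `|X * t / 4| = s / 2.
  have -> : X * t / 4 = t * X / 2 * 2^-1 by field.
  by rewrite normrM (ger0_norm (_ : 0 <= 2^-1)).
rewrite sE in nut.
have s0 : 0 < s by lra.
have nus : 2 * nu <= s by lra.
have -> : `|4 * nu / (X * t)| = 2 * nu / s.
  have Xt : X * t != 0.
    apply/negP => /eqP Xt; move: s0.
    by rewrite /s (mulrC t X) Xt mul0r normr0 ltxx.
  have -> : 4 * nu / (X * t) = 2 * nu / (t * X / 2).
    by field; move: Xt; rewrite mulf_eq0 negb_or => /andP[-> ->].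
  by rewrite normrM normfV -/s ger0_norm//; lra.
set w := s `^ (nu + 1); have w0 : 0 < w by rewrite powR_gt0.
have -> : (2 * nu / s) `^ (2 * nu + 2) = (2 * nu) `^ (2 * nu + 2) / w ^+ 2.
  rewrite powRM ?invr_ge0 ?(ltW s0)//; last by lra.
  congr (_ * _); rewrite powRVN ?(ltW s0)// powRN; congr (_^-1).
  rewrite expr2 /w -powRD ?(gt_eqF s0) ?implybT//; congr powR; ring.
have F2 : cosT nu s ^+ 2 <= (C0 * stirling nu) ^+ 2 / w ^+ 2.
  rewrite ler_pdivlMr ?exprn_gt0// -exprMn mulrC -/(scosT nu s).
  rewrite -(real_normK (num_real (scosT nu s))) lerXn2r ?nnegrE//.
    by rewrite mulr_ge0 ?(ltW C00)// ltW// stirling_gt0// ltW.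
  by apply: HW => //; exact: ltW.
have c0 := gnorm_gt0 nu0.
have cX : 0 <= 2 * gnorm nu * X.
  by apply: mulr_ge0 (ltW X0); exact: mulr_ge0 (ltW c0).
rewrite ger0_norm; last by apply: mulr_ge0 cX _; exact: sqr_ge0.
have M := sqrt_stirling_le e0 enu; rewrite -/Q in M.
set V := nu `^ _ in M *; set E := expR (- (2 * nu)) in M *.
set Z := (2 * nu) `^ _ in M *; set sq := Num.sqrt (4 * nu + 2) in M.
apply: (@le_trans _ _ (2 * (sq * expR 1) * X * ((C0 * stirling nu) ^+ 2 / w ^+ 2))).
  apply: ler_pM; [exact: cX|exact: sqr_ge0| |exact: F2].
  by rewrite ler_wpM2r ?(ltW X0)// ler_wpM2l// gnorm_le.
have -> : 2 * (sq * expR 1) * X * ((C0 * stirling nu) ^+ 2 / w ^+ 2) =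
  2 * expR 1 * C0 ^+ 2 * X / w ^+ 2 * (sq * stirling nu ^+ 2) by ring.
have -> : 2 * expR 1 * C0 ^+ 2 * Q * (V * E * X * (Z / w ^+ 2)) =
  2 * expR 1 * C0 ^+ 2 * X / w ^+ 2 * (Q * (V * E * Z)) by ring.
apply: ler_wpM2l => //.
apply: divr_ge0; last exact: sqr_ge0.
apply: mulr_ge0; last exact: ltW.
by apply: mulr_ge0; [rewrite mulr_ge0 ?expR_ge0|exact: sqr_ge0].
Qed.

Lemma g_nuX0 nu X : 0 < nu -> g_nuX nu X 0 = 1.
Proof.
move=> nu0; rewrite g_nuXE// -(gnorm_bump nu0); congr (_ * _).
apply: eq_Rintegral => y _; rewrite mulr0 mul0r sub0r bumpN /bump.
have -> : 2 * nu = nu + nu by ring.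
by rewrite powRD//; apply/implyP => /eqP ?; exfalso; lra.
Qed.

Lemma g_nuX_support nu X x : 0 < nu -> 0 < X -> g_nuX nu X x != 0 -> x <= X.
Proof.
move=> nu0 X0; apply: contraNle => Xx; rewrite g_nuXE// self_conv_out ?mulr0//.
by rewrite ltr_pdivlMr// ltr_pM2l.
Qed.

Lemma h_nuX_ge0 nu X t : 0 < nu -> 0 < X -> 0 <= h_nuX nu X t.
Proof.
move=> nu0 X0; rewrite h_nuXE//.
apply: mulr_ge0; last exact: sqr_ge0.
by apply: mulr_ge0 (ltW X0); exact: mulr_ge0 (ltW (gnorm_gt0 nu0)).
Qed.

End Final.
Theorem lemmaA1 (R : realType) :
  (forall nu X : R, 0 < nu -> 0 < X ->
     [/\ g_nuX nu X 0 = 1,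
         (forall x : R, 0 <= x -> g_nuX nu X x != 0 -> x <= X) &
         (forall t : R, 0 <= h_nuX nu X t)]) /\
  (forall eps : R, 0 < eps -> exists C : R, 0 < C /\
     forall nu X t : R, 0 < X -> eps <= nu -> nu <= `|X * t / 4| ->
       `|h_nuX nu X t| <=
         C * (nu `^ (- (1 / 2)) * expR (- (2 * nu)) * X
              * `|4 * nu / (X * t)| `^ (2 * nu + 2))).
Proof.
split.
  move=> nu X nu0 X0; split; first exact: g_nuX0.
    by move=> x _; exact: g_nuX_support.
  by move=> t; exact: h_nuX_ge0.
move=> eps e0; have [C C0 H] := @h_nuX_bound R eps e0.
by exists C; split.
Qed.
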